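(* Let $(M,\Sigma,\mu)$ be a $\sigma$-finite measure space and let $(x_t,f_t)_{t\in M}\subseteq X\times X^*$ be a continuous Schauder frame for a separable Banach space $X$. Then $(x_t,f_t)_{t\in M}$ is boundedly complete if and only if $c_0$ does not embed into $X$ (that is, no closed subspace of $X$ is isomorphic to $c_0$).
   Context: Pettis integral: for a $\sigma$-finite measure space $(M,\Sigma,\mu)$ and a separable Banach space $X$, a function $F:M\to X$ is Pettis integrable if for every $E\in\Sigma$ there is $x_E\in X$ with $f(x_E)=\int_E f(F)\,d\mu$ (Lebesgue integral) for all $f\in X^*$; then $\int_E F\,d\mu:=x_E$. Continuous Schauder frame: a measurable map $t\mapsto (x_t,f_t)\in X\times X^*$ on $M$, where $X$ is a separable Banach space, is a continuous Schauder frame of $X$ if for every $x\in X$ the function $t\mapsto f_t(x)x_t$ is Pettis integrable and $x=\int_M f_t(x)x_t\,d\mu(t)$. Directed set: $\mathcal D=\{E\in\Sigma:\mu(E)<\infty \text{ and } \sup_{t\in E}\|f_t\|\|x_t\|<\infty\}$, ordered by inclusion ($E\preceq F$ iff $E\subseteq F$). For $E\in\mathcal D$ and $x^{**}\in X^{**}$ the Pettis integral $\int_E x^{**}(f_t)x_t\,d\mu(t)$ exists as an element of $X$. Boundedly complete: the continuous Schauder frame $(x_t,f_t)_{t\in M}$ is boundedly complete if for every $x^{**}\in X^{**}$ the net $\left(\int_E x^{**}(f_t)x_t\,d\mu(t)\right)_{E\in\mathcal D}$ converges in norm to an element of $X$. *)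

(* Defs.v *)
From HB Require Import structures.
From mathcomp Require Import all_boot all_order all_algebra.
From mathcomp Require Import all_classical all_reals all_analysis.

Set Implicit Arguments.
Unset Strict Implicit.
Unset Printing Implicit Defensive.

Import Order.TTheory GRing.Theory Num.Theory.
Import numFieldNormedType.Exports.

Local Open Scope classical_set_scope.
Local Open Scope ring_scope.

Section dual_space.
Context {R : realType} (V : normedModType R).

Definition dual_pred : {pred V -> R^o} :=
  fun f => `[< linear f /\ continuous f >].

Record dual_space := Dual {
  dual_fun :> V -> R^o ;
  dual_funP : dual_fun \in dual_pred }.

HB.instance Definition _ := [isSub for dual_fun].
HB.instance Definition _ := gen_eqMixin dual_space.
HB.instance Definition _ := gen_choiceMixin dual_space.

Fact dual_submod_closed : submod_closed dual_pred.
Proof.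
split=> [|a f g /asboolP[lf cf] /asboolP[lg cg]]; apply/asboolP; split.
- by move=> a u v; rewrite /= scaler0 addr0.
- by move=> x; exact: cvg_cst.
- move=> k u v; have := lf k u v; have := lg k u v.
  rewrite /= => guv fuv; rewrite !fctE /= guv fuv !scalerDr addrACA.
  by congr (_ + _ + _); rewrite !scalerA mulrC.
- by move=> x; apply: cvgD; [apply: cvgZl_tmp; exact: cf|exact: cg].
Qed.

HB.instance Definition _ := GRing.isSubmodClosed.Build _ _ dual_pred
  dual_submod_closed.
HB.instance Definition _ := [SubChoice_isSubLmodule of dual_space by <:].

Lemma dual_linear (f : dual_space) : linear f.
Proof. by case/asboolP: (dual_funP f). Qed.

Lemma dual_continuous (f : dual_space) : continuous f.
Proof. by case/asboolP: (dual_funP f). Qed.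

HB.instance Definition _ (f : dual_space) :=
  GRing.isLinear.Build R V R^o *:%R (dual_fun f) (dual_linear f).

Definition dual_norm (f : dual_space) : R :=
  sup [set `|f x| | x in [set x : V | `|x| <= 1]].

Lemma dual_norm_has_sup (f : dual_space) :
  has_sup [set `|f x| | x in [set x : V | `|x| <= 1]].
Proof.
split; first by exists `|f 0|, 0 => //=; rewrite normr0.
have /linear_bounded_continuous/bounded_funP/(_ 1)[M fM] :
  continuous (f : {linear V -> R^o}) := @dual_continuous f.
by exists M => _ [x /= x1 <-]; exact: fM.
Qed.

Lemma dual_norm_ub (f : dual_space) (x : V) : `|f x| <= dual_norm f * `|x|.
Proof.
have [->|x0] := eqVneq x 0; first by rewrite linear0 !normr0 mulr0.
have x_gt0 : 0 < `|x| by rewrite normr_gt0.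
rewrite -ler_pdivrMr//.
apply: (sup_upper_bound (dual_norm_has_sup f)).
exists (`|x|^-1 *: x).
  by rewrite /= normrZ normfV normr_id mulVf// gt_eqF.
by rewrite linearZ normrZ normfV normr_id mulrC.
Qed.

Lemma dual_norm_le (f : dual_space) (r : R) :
  (forall x, `|x| <= 1 -> `|f x| <= r) -> dual_norm f <= r.
Proof.
move=> fr; apply: ge_sup; first by case: (dual_norm_has_sup f).
by move=> _ [x /= x1 <-]; exact: fr.
Qed.

Lemma dual_norm_ge0 (f : dual_space) : 0 <= dual_norm f.
Proof.
apply: (le_trans (normr_ge0 (f 0))).
apply: (sup_upper_bound (dual_norm_has_sup f)).
by exists 0 => //=; rewrite normr0.
Qed.

Lemma dual_norm1 (f : dual_space) (x : V) : `|x| <= 1 -> `|f x| <= dual_norm f.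
Proof.
move=> x1; apply: (sup_upper_bound (dual_norm_has_sup f)).
by exists x.
Qed.

Fact dual_ler_normD (f g : dual_space) :
  dual_norm (f + g) <= dual_norm f + dual_norm g.
Proof.
apply: dual_norm_le => x x1.
apply: (le_trans (ler_normD (f x) (g x))).
by apply: lerD; exact: dual_norm1.
Qed.

Fact dual_normZ_le (l : R) (f : dual_space) :
  dual_norm (l *: f) <= `|l| * dual_norm f.
Proof.
apply: dual_norm_le => x x1.
have -> : (l *: f) x = l * f x by [].
by rewrite normrM ler_wpM2l// dual_norm1.
Qed.

Fact dual_normrZ (l : R) (f : dual_space) :
  dual_norm (l *: f) = `|l| * dual_norm f.
Proof.
apply/eqP; rewrite eq_le dual_normZ_le /=.
have [->|l0] := eqVneq l 0; first by rewrite normr0 mul0r dual_norm_ge0.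
rewrite mulrC -ler_pdivlMr ?normr_gt0// mulrC -normfV.
by rewrite -{1}[f](scalerK l0) dual_normZ_le.
Qed.

Fact dual_normr0_eq0 (f : dual_space) : dual_norm f = 0 -> f = 0.
Proof.
move=> f0; apply/val_inj/funext => x /=; apply/eqP.
by rewrite -normr_le0 (le_trans (dual_norm_ub f x))// f0 mul0r.
Qed.

HB.instance Definition _ := Lmodule_isNormed.Build R dual_space
  dual_ler_normD dual_normrZ dual_normr0_eq0.

End dual_space.

Section c0.
Context (R : realType).

Definition c0_pred : {pred nat -> R^o} :=
  fun u => `[< u @ \oo --> (0 : R^o) >].

Record c0 := C0 {
  c0_seq :> nat -> R^o ;
  c0_seqP : c0_seq \in c0_pred }.

HB.instance Definition _ := [isSub for c0_seq].
HB.instance Definition _ := gen_eqMixin c0.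
HB.instance Definition _ := gen_choiceMixin c0.

Fact c0_submod_closed : submod_closed c0_pred.
Proof.
split=> [|a u v /asboolP u0 /asboolP v0]; apply/asboolP; first exact: cvg_cst.
have -> : (0 : R^o) = a *: (0 : R^o) + 0 by rewrite scaler0 addr0.
by apply: cvgD => //; exact: cvgZl_tmp.
Qed.

HB.instance Definition _ := GRing.isSubmodClosed.Build _ _ c0_pred
  c0_submod_closed.
HB.instance Definition _ := [SubChoice_isSubLmodule of c0 by <:].

Lemma c0_cvg (u : c0) : u @ \oo --> (0 : R^o).
Proof. by case: u => u /= /asboolP. Qed.

Definition c0_norm (u : c0) : R := sup (range (fun n => `|u n|)).

Lemma c0_norm_has_sup (u : c0) : has_sup (range (fun n => `|u n|)).
Proof.
split; first by exists `|u 0|, 0%N.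
have /cvg_ex/cvg_seq_bounded[M [_ uM]] : exists l, u @ \oo --> (l : R^o).
  by exists 0; exact: c0_cvg.
exists (M + 1) => _ [n _ <-].
by apply: (uM (M + 1)) => //; rewrite ltrDl.
Qed.

Lemma c0_norm_ub (u : c0) n : `|u n| <= c0_norm u.
Proof. by apply: (sup_upper_bound (c0_norm_has_sup u)); exists n. Qed.

Lemma c0_norm_le (u : c0) (r : R) :
  (forall n, `|u n| <= r) -> c0_norm u <= r.
Proof.
move=> ur; apply: ge_sup; first by case: (c0_norm_has_sup u).
by move=> _ [n _ <-].
Qed.

Fact c0_ler_normD (u v : c0) : c0_norm (u + v) <= c0_norm u + c0_norm v.
Proof.
apply: c0_norm_le => n; apply: (le_trans (ler_normD (u n) (v n))).
by apply: lerD; exact: c0_norm_ub.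
Qed.

Fact c0_normZ_le (l : R) (u : c0) : c0_norm (l *: u) <= `|l| * c0_norm u.
Proof.
apply: c0_norm_le => n.
have -> : (l *: u) n = l * u n by [].
by rewrite normrM ler_wpM2l// c0_norm_ub.
Qed.

Fact c0_normrZ (l : R) (u : c0) : c0_norm (l *: u) = `|l| * c0_norm u.
Proof.
apply/eqP; rewrite eq_le c0_normZ_le /=.
have [->|l0] := eqVneq l 0.
  by rewrite normr0 mul0r (le_trans _ (c0_norm_ub _ 0)).
rewrite mulrC -ler_pdivlMr ?normr_gt0// mulrC -normfV.
by rewrite -{1}[u](scalerK l0) c0_normZ_le.
Qed.

Fact c0_normr0_eq0 (u : c0) : c0_norm u = 0 -> u = 0.
Proof.
move=> u0; apply/val_inj/funext => n /=; apply/eqP.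
by rewrite -normr_le0 -u0 c0_norm_ub.
Qed.

HB.instance Definition _ := Lmodule_isNormed.Build R c0
  c0_ler_normD c0_normrZ c0_normr0_eq0.

End c0.

Definition separable (T : topologicalType) : Prop :=
  exists2 S : set T, countable S & dense S.

Definition closed_subspace {R : realType} {V : normedModType R} (Y : set V) :=
  closed Y /\ submod_closed (mem Y).

Definition isomorphic_onto {R : realType} (V W : normedModType R) (Y : set W) :=
  exists (T : V -> W) (S : W -> V),
    [/\ linear T, range T = Y, cancel T S, continuous T &
        {within Y, continuous S}].

Definition c0_embeds {R : realType} (X : normedModType R) : Prop :=
  exists2 Y : set X, closed_subspace Y & isomorphic_onto (c0 R) Y.

Section pettis.
Context {d : measure_display} {M : measurableType d} {R : realType}.
Variable mu : {measure set M -> \bar R}.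

(* Measurability of Banach-valued functions: Borel measurability for the norm
   topology and an essentially separable range; by Pettis' theorem this means
   being a.e. a limit of simple functions. The second clause is automatic when
   [V] is separable, but not for maps into a nonseparable dual: there it can
   fail if real-valued measurable cardinals exist. *)
Definition strongly_measurable {V : normedModType R} (F : M -> V) : Prop :=
  (forall U : set V, open U -> measurable (F @^-1` U)) /\
  exists2 S : set V, countable S & {ae mu, forall t, closure S (F t)}.

Definition has_pettis_integral {X : normedModType R}
    (E : set M) (F : M -> X) (y : X) : Prop :=
  forall g : dual_space X,
    mu.-integrable E (fun t => (g (F t))%:E) /\
    g y = \int[mu]_(t in E) g (F t).

Definition pettis_integrable {X : normedModType R} (F : M -> X) : Prop :=
  forall E, measurable E -> exists y, has_pettis_integral E F y.

(* [0] when the integral does not exist. *)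
Definition pettis_integral {X : normedModType R}
    (E : set M) (F : M -> X) : X :=
  xget 0 [set y | has_pettis_integral E F y].

End pettis.

Section frames.
Context {d : measure_display} {M : measurableType d} {R : realType}.
Variables (mu : {measure set M -> \bar R}) (X : normedModType R).
Variables (x : M -> X) (f : M -> dual_space X).

Definition continuous_schauder_frame : Prop :=
  strongly_measurable mu (fun t => (x t, f t)) /\
  forall v : X,
    pettis_integrable mu (fun t => f t v *: x t) /\
    v = pettis_integral mu setT (fun t => f t v *: x t).

Definition frame_domain : set (set M) :=
  [set E | [/\ measurable E, (mu E < +oo)%E &
     exists C : R, forall t, E t -> `|f t| * `|x t| <= C]].

(* The filter of tails of the directed set [frame_domain], ordered by inclusion:
   convergence along it is convergence of nets indexed by [frame_domain]. *)
Definition frame_net : set_system (set M) :=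
  filter_from frame_domain
    (fun E0 => [set E | frame_domain E /\ E0 `<=` E]).

Definition boundedly_complete : Prop :=
  forall g : dual_space (dual_space X), exists y : X,
    pettis_integral mu E (fun t => g (f t) *: x t) @[E --> frame_net] --> y.

End frames.

(* Main.v *)
Require Import Defs.
From HB Require Import structures.
From mathcomp Require Import all_boot all_order all_algebra.
From mathcomp Require Import all_classical all_reals all_analysis.
From mathcomp Require Import measurable_realfun ring lra.

(* If c_0 does not embed and the net I(E), the integral over E of
   x**(f_t) x_t, were not Cauchy, there would be disjoint E_n in the domain with
   |I(E_n)| >= e. By Banach-Steinhaus on X and X*, the sums of |g(I(E_n))| are
   bounded by K |g|; here x** is moved outside the integral by integrating
   g(x_t) f_t in X*. Rosenthal's lemma then extracts a subsequence of I(E_n)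
   equivalent to the unit vector basis of c_0.

   Conversely, let T embed c_0 in X, w_n = T(1,...,1,0,...) with n ones and
   x** = lim w_n in the weak* topology. Averaging over signs shows that block
   sums of the unit vectors are dominated in L^1, so f_t(w_n) g(x_t) is Cauchy
   in L^1 for each g in X*, and lim_E I(E) = y forces g(w_n) --> g(y). Hence y
   lies in the closure of w_n + T{u : u_k = 0 for k < n} for every n, which the
   lower bound of T forbids since sequences in c_0 tend to 0. *)

Set Implicit Arguments.
Unset Strict Implicit.
Unset Printing Implicit Defensive.

Import Order.TTheory GRing.Theory Num.Theory.
Import numFieldNormedType.Exports.

Local Open Scope classical_set_scope.
Local Open Scope ring_scope.

(** * Hahn-Banach and duality *)

(** The frame identity concerns vectors of X only, and x** need not be weak* continuous, so bounds
    at points of X say nothing directly about x**. The integrals over E of g(x_t) f_t remedy this: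
    being bounded pointwise on X they are bounded in norm, and every x** is then controlled at once.
    Their existence in X* is the reason for constructing Pettis integrals in a general Banach space
    from strong measurability, and for proving that X* is complete.

    In the other direction the limits in n and E can be exchanged only with smallness uniform in E.
    Pointwise convergence of f_t(w_n) does not give this in L^1, as a majorant is missing. The
    structure of c_0 supplies it: signed sums of disjoint blocks stay bounded, and a pointwise null
    sequence in L^1 with bounded signed sums has an integrable supremum, an instance of L^1
    containing no c_0. The final contradiction reflects that the summing basis of c_0 has no weak
    limit: the only candidate is the constant sequence 1. *)

Definition sublinear {R : numDomainType} {V : lmodType R} (q : V -> R) :=
  (forall u v, q (u + v) <= q u + q v) /\
  (forall a u, 0 <= a -> q (a *: u) = a * q u).

Section hahn_banach.
Context {R : realType} {V : lmodType R}.
Implicit Types (p q : V -> R) (u v : V).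

Lemma sublinear0 q : sublinear q -> q 0 = 0.
Proof. by case=> _ /(_ 0 0 (lexx 0)); rewrite scale0r mul0r. Qed.

Lemma sublinear_ge q u : sublinear q -> - q (- u) <= q u.
Proof.
move=> sq; rewrite -subr_ge0 opprK -(sublinear0 sq) -[X in q X](subrr u).
exact: sq.1.
Qed.

(** The infimum over [t >= 0] of [q (u + t *: v) - t * q v] is the largest sublinear minorant of [q]
    with value at most [- q v] at [- v]; [t = 0] and [t = 1] give the two bounds. It is finite
    because subadditivity puts every term above [- q (- u)]. *)
Lemma sublinear_subr q v : sublinear q ->
  exists2 r : V -> R, sublinear r & forall u, r u <= q u /\ r u <= q (u + v) - q v.
Proof.
move=> sq; have [qD qZ] := sq.
pose A u := [set q (u + t *: v) - t * q v | t in [set t : R | 0 <= t]].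
have A0 u : A u !=set0 by exists (q (u + 0 *: v) - 0 * q v), 0 => /=.
have Alb u : has_lbound (A u).
  exists (- q (- u)) => _ [t /= t0 <-].
  have := qD (u + t *: v) (- u); rewrite addrAC subrr add0r qZ//; lra.
have Ai u t : 0 <= t -> inf (A u) <= q (u + t *: v) - t * q v.
  by move=> t0; apply: ge_inf => //; exists t.
exists (fun u => inf (A u)).
  split=> [u u'|a u].
    rewrite -lerBlDl; apply: lb_le_inf => // _ [t /= t0 <-].
    rewrite lerBlDl -lerBlDr; apply: lb_le_inf => // _ [s /= s0 <-].
    have := Ai (u + u') _ (addr_ge0 s0 t0).
    by have := qD (u + s *: v) (u' + t *: v); rewrite addrACA -scalerDl; lra.
  rewrite le_eqVlt => /predU1P[<-|a0].
    rewrite scale0r mul0r; apply/eqP; rewrite eq_le; apply/andP; split.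
      by rewrite (le_trans (Ai _ 0 (lexx _)))// scale0r mul0r addr0 subr0 sublinear0.
    by apply: lb_le_inf => // _ [t /= t0 <-]; rewrite add0r qZ// subrr.
  have a0' := ltW a0; have ai0 : 0 <= a^-1 by rewrite invr_ge0.
  apply/eqP; rewrite eq_le; apply/andP; split.
    rewrite -ler_pdivrMl//; apply: lb_le_inf => // _ [t /= t0 <-].
    rewrite ler_pdivrMl//; apply: (le_trans (Ai _ _ (mulr_ge0 a0' t0))).
    by rewrite -scalerA -scalerDr qZ// mulrBr mulrA.
  apply: lb_le_inf => // _ [t /= t0 <-].
  rewrite -ler_pdivlMl//; apply: (le_trans (Ai _ _ (mulr_ge0 ai0 t0))).
  rewrite mulrBr -(qZ _ (a *: _ + _))// scalerDr !scalerA mulVf ?gt_eqF//.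
  by rewrite scale1r mulrA.
move=> u; split.
  by rewrite (le_trans (Ai _ 0 (lexx _)))// scale0r mul0r addr0 subr0.
by rewrite (le_trans (Ai _ 1 ler01))// scale1r mul1r.
Qed.

(** Zorn's lemma, with the order reversed so that maximal elements are minimal functionals. The
    pointwise infimum of a chain is finite, as [- p (- u)] lies below every minorant, and
    subadditive because of two members of a chain one lies below the other everywhere. *)
Lemma minimal_sublinear p : sublinear p -> exists q, [/\ sublinear q,
  forall u, q u <= p u &
  forall r, sublinear r -> (forall u, r u <= q u) -> forall u, q u <= r u].
Proof.
move=> sp; pose T := {q : V -> R | sublinear q /\ forall u, q u <= p u}.
pose le (q r : T) := `[< forall u, sval r u <= sval q u >].
pose t0 : T := exist _ p (conj sp (fun u => lexx _)).
have [||A totA|[q [sq qp]] qmin] := @ZL_preorder T t0 le.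
- by move=> q; apply/asboolP.
- move=> q r s /asboolP qr /asboolP rs; apply/asboolP=> u.
  exact: le_trans (rs u) (qr u).
- have [[q0 Aq0]|A0] := pselect (exists q : T, A q); last first.
    exists t0 => q Aq.
    by exfalso; apply: A0; exists q.
  pose B u := [set sval q u | q in A].
  have B0 u : B u !=set0 by exists (sval q0 u), q0.
  have Blb u : has_lbound (B u).
    exists (- p (- u)) => _ [[q [sq qp]] _ <-] /=.
    by rewrite (le_trans _ (sublinear_ge u sq))// lerN2.
  have Bi u (q : T) : A q -> inf (B u) <= sval q u.
    by move=> Aq; apply: ge_inf => //; exists q.
  have sB : sublinear (fun u => inf (B u)).
    split=> [u v|a u].
      rewrite -lerBlDl; apply: lb_le_inf => // _ [q Aq <-].
      rewrite lerBlDl -lerBlDr; apply: lb_le_inf => // _ [r Ar <-].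
      rewrite lerBlDr; have [/asboolP rq|/asboolP qr] := totA _ _ Aq Ar.
        rewrite (le_trans (Bi _ _ Ar))// (le_trans ((svalP r).1.1 u v))// lerD2l.
        exact: rq.
      rewrite (le_trans (Bi _ _ Aq))// (le_trans ((svalP q).1.1 u v))// lerD2r.
      exact: qr.
    rewrite le_eqVlt => /predU1P[<-|a0].
      rewrite scale0r mul0r; apply/eqP; rewrite eq_le; apply/andP; split.
        by rewrite (le_trans (Bi _ _ Aq0))// (sublinear0 (svalP q0).1).
      by apply: lb_le_inf => // _ [q Aq <-]; rewrite (sublinear0 (svalP q).1).
    have a0' := ltW a0.
    apply/eqP; rewrite eq_le; apply/andP; split.
      rewrite -ler_pdivrMl//; apply: lb_le_inf => // _ [q Aq <-].
      by rewrite ler_pdivrMl// -(svalP q).1.2// Bi.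
    apply: lb_le_inf => // _ [q Aq <-].
    by rewrite (svalP q).1.2// ler_pM2l// Bi.
  have Bp u : inf (B u) <= p u.
    by rewrite (le_trans (Bi _ _ Aq0))// (svalP q0).2.
  exists (exist _ (fun u => inf (B u)) (conj sB Bp)) => q Aq.
  by apply/asboolP => u /=; exact: Bi.
exists q; split=> // r sr rq u.
have rp v : r v <= p v by exact: le_trans (rq v) (qp v).
by have /asboolP := qmin (exist _ r (conj sr rp)) (asboolT rq); exact.
Qed.

(* A minimal sublinear functional [q] is additive: the sublinear minorant
   given by [sublinear_subr] must coincide with [q]. *)
Lemma hahn_banach p v : sublinear p ->
  exists g : V -> R, [/\ linear (g : V -> R^o), forall u, g u <= p u & g v = p v].
Proof.
move=> sp; have [r sr rp] := sublinear_subr v sp.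
have [q [sq qr qmin]] := minimal_sublinear sr.
have qD u w : q (u + w) = q u + q w.
  apply/eqP; rewrite eq_le sq.1 -lerBrDr.
  have [s ss sq'] := sublinear_subr w sq.
  by apply: le_trans (qmin s ss _ u) (sq' u).2 => z; exact: (sq' z).1.
have qN u : q (- u) = - q u.
  by apply/eqP; rewrite -addr_eq0 addrC -qD subrr sublinear0.
have qp u : q u <= p u by exact: le_trans (qr u) (rp u).1.
exists q; split=> //.
  move=> a u w; rewrite qD; congr (_ + _).
  have [a0|/ltW a0] := leP 0 a; first exact: sq.2.
  by rewrite -[a]opprK scaleNr qN sq.2 ?oppr_ge0// scaleNr.
(* [q (- v) <= r (- v) <= p (- v + v) - p v = - p v]: the second bound on [r] fixes the value at
   [v]. *)
apply/eqP; rewrite eq_le qp -lerN2 -qN.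
by rewrite (le_trans (qr _))// (le_trans (rp _).2)// addNr sublinear0// sub0r.
Qed.

End hahn_banach.

Section dual_theory.
Context {R : realType} {V : normedModType R}.
Implicit Types (f g : dual_space V) (x y : V).

Lemma dual_apply_le f x : `|f x| <= `|f| * `|x|.
Proof. exact: dual_norm_ub. Qed.

Lemma dual_le_bound f (C : R) :
  0 <= C -> (forall x, `|f x| <= C * `|x|) -> `|f| <= C.
Proof.
move=> C0 fC; apply: dual_norm_le => x x1.
by rewrite (le_trans (fC x))// ler_piMr.
Qed.

Lemma linear_bounded_dual (h : V -> R^o) (C : R) : linear h ->
  (forall x, `|h x| <= C * `|x|) -> exists f : dual_space V, (f : V -> R^o) = h.
Proof.
move=> lh hC.
pose H := GRing.isLinear.Build R V R^o *:%R h lh.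
pose h' : {linear V -> R^o} := HB.pack h H.
have ch : continuous h.
  apply/(linear_bounded_continuous h')/bounded_funP => r.
  exists (`|C| * r) => x xr; rewrite (le_trans (hC x))//.
  rewrite (le_trans (ler_norm _))// normrM normr_id ler_wpM2l//.
have hP : h \in @dual_pred R V by exact/asboolP.
by exists (Dual hP).
Qed.

(** Serves twice: with the norm as [p] it gives norming functionals, with the distance to a subspace
    it gives separation. *)
Lemma dual_seminorm_ex (p : V -> R) (C : R) x :
  (forall u v, p (u + v) <= p u + p v) -> (forall a u, p (a *: u) = `|a| * p u) ->
  (forall u, p u <= C * `|u|) ->
  exists2 f : dual_space V, forall u, `|f u| <= p u & f x = p x.
Proof.
move=> pD pZ pC.
have sp : sublinear p by split=> // a u a0; rewrite pZ ger0_norm.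
have [h [lh hp hx]] := hahn_banach x sp.
have {}hp u : `|h u| <= p u.
  rewrite ler_norml hp andbT lerNl.
  have -> : - h u = h (- u).
    by have := lh (-1) u 0; rewrite scaleN1r addr0 => ->; rewrite scaleN1r
      (_ : h 0 = 0) ?addr0//; have := lh (-1) 0 0; rewrite scaler0 addr0 scaleN1r addNr.
  by rewrite (le_trans (hp _))// -scaleN1r pZ normrN1 mul1r.
have [f fh] := linear_bounded_dual lh (fun u => le_trans (hp u) (pC u)).
by exists f; rewrite fh.
Qed.

Lemma dual_norming x : exists2 f : dual_space V, `|f| <= 1 & f x = `|x|.
Proof.
have [||u|f fle fx] := @dual_seminorm_ex (fun u => `|u|) 1 x.
- exact: ler_normD.
- exact: normrZ.
- by rewrite mul1r.
- by exists f => //; apply: dual_le_bound => // u; rewrite mul1r.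
Qed.

(** The candidate is the pointwise limit [l]; a ball estimate survives the passage to it with the
    same radius ([lF]), which upgrades pointwise to norm convergence. Completeness of the dual is
    needed for Pettis integrals with values in it and for Banach-Steinhaus on it. *)
Lemma dual_complete (F : set_system (dual_space V)) :
  ProperFilter F -> cauchy F -> cvg F.
Proof.
move=> FF /cauchyP Fc.
have ev_c x : cvg ((f : dual_space V) x @[f --> F]).
  apply/cauchy_cvgP/cauchyP => e e0.
  have x0 : 0 < `|x| + 1 by rewrite ltr_wpDl.
  have [f0 Ff0] := Fc _ (divr_gt0 e0 x0).
  exists (f0 x); rewrite /fmap /=; near=> f.
  have : `|f0 - f| < e / (`|x| + 1).
    by near: f; move: Ff0; rewrite -ball_normE.
  rewrite -ball_normE /= ltr_pdivlMr// => fe.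
  apply: le_lt_trans fe; rewrite -[f0 x - f x]/((f0 - f) x).
  by rewrite (le_trans (dual_apply_le _ _))// ler_wpM2l// lerDl.
pose l x := lim ((f : dual_space V) x @[f --> F]).
have lE x : (f : dual_space V) x @[f --> F] --> l x by exact: ev_c.
have ll : linear (l : V -> R^o).
  move=> a u v; apply: cvg_lim => //.
  under eq_fun do rewrite linearP.
  exact: cvgD (cvgZl_tmp (lE u)) (lE v).
have lF (f0 : dual_space V) (e : R) x :
    F (ball f0 e) -> `|f0 x - l x| <= e * `|x|.
  move=> Ff0.
  have c : `|f0 x - f x| @[f --> F] --> `|f0 x - l x|.
    by apply: cvg_norm; exact: cvgB (cvg_cst _) (lE x).
  apply: (@closed_cvg _ _ _ FF _ [set y | y <= e * `|x|] _ _ _ c).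
    exact: closed_le.
  near=> f => /=; rewrite -[f0 x - f x]/((f0 - f) x).
  rewrite (le_trans (dual_apply_le _ _))// ler_wpM2r//.
  by apply: ltW; near: f; move: Ff0; rewrite -ball_normE.
have [f0 Ff0] := Fc _ ltr01.
have lb x : `|l x| <= (`|f0| + 1) * `|x|.
  rewrite mulrDl -[l x](subKr (f0 x)) (le_trans (ler_normB _ _))//.
  by rewrite lerD ?dual_apply_le// lF.
have [f fl] := linear_bounded_dual ll lb.
apply/cvg_ex; exists f; apply/cvgrPdist_le => e e0.
have [f1 Ff1] := Fc _ (divr_gt0 e0 (ltr0Sn R 1)).
near=> h; rewrite -[f](subrK f1) -addrA (le_trans (ler_normD _ _))//.
rewrite [e]splitr lerD//.
  rewrite distrC; apply: dual_le_bound; first by rewrite divr_ge0 ?ltW.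
  by move=> x; rewrite -[(f1 - f) x]/(f1 x - f x) fl; exact: lF.
by apply: ltW; near: h; move: Ff1; rewrite -ball_normE.
Unshelve. all: by end_near. Qed.

HB.instance Definition _ :=
  Uniform_isComplete.Build (dual_space V) dual_complete.

End dual_theory.

Lemma dual_uniform_bounded (R : realType) (V : completeNormedModType R)
    (F : set (dual_space V)) :
  (forall x, exists C, forall f, F f -> `|f x| <= C) ->
  exists2 C : R, 0 <= C & forall f, F f -> `|f| <= C.
Proof.
move=> Fb.
have [||C FC] := @Banach_Steinhauss R V R^o [set (f : V -> R^o) | f in F] _ _ 1.
- move=> _ [f _ <-]; split; last exact: dual_linear.
  move=> r; exists (`|f| * r) => x xr.
  by rewrite (le_trans (dual_apply_le _ _))// ler_wpM2l.
- by move=> x; have [C FC] := Fb x; exists C => _ [f Ff <-]; exact: FC.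
- exists `|C| => // f Ff; apply: dual_norm_le => x x1.
  by rewrite (le_trans _ (ler_norm _))// FC//; exists f.
Qed.

(** * Copies of c_0 *)

(* Kupka's argument: split the index set into infinitely many infinite pieces;
   if none of them works, a transversal of bad indices has row sums smaller by
   [delta]. *)
Lemma rosenthal (R : realType) (a : nat -> nat -> R) (K delta : R) :
  (forall i j, 0 <= a i j) -> 0 < delta ->
  (forall i s, uniq s -> \sum_(j <- s) a i j <= K) ->
  exists2 phi : nat -> nat, injective phi &
    forall i s, uniq s -> i \notin s ->
      \sum_(j <- s) a (phi i) (phi j) <= delta.
Proof.
(* Induction on how often [delta] fits into [K]: each failure lowers the bound on row sums by
   [delta], and for [n = 0] all row sums are at most 0. *)
move=> a0 d0 aK; have [n] : exists n : nat, K <= n%:R * delta.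
  exists (Num.truncn (K / delta)).+1.
  by rewrite -ler_pdivrMr// ltW// truncnS_gt.
elim: n a a0 K aK => [|n IH] a a0 K aK Kn.
  exists id => // i s us _; rewrite (le_trans (aK i s us))// (le_trans Kn)//.
  by rewrite mul0r ltW.
pose pi (p i : nat) : nat := pickle (p, i).
have pi_inj p q i j : pi p i = pi q j -> p = q /\ i = j.
  by move=> /(pcan_inj pickleK)[].
pose good (phi : nat -> nat) := forall i s, uniq s -> i \notin s ->
  \sum_(j <- s) a (phi i) (phi j) <= delta.
have [[p pp]|np] := pselect (exists p, good (pi p)).
  by exists (pi p) => // i j /pi_inj[].
have bad p : exists x : nat * seq nat, [/\ uniq x.2, x.1 \notin x.2 &
    delta < \sum_(j <- x.2) a (pi p x.1) (pi p j)].
  apply: contrapT => nbad; apply: np; exists p => i s us ins.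
  rewrite leNgt; apply/negP => ds; apply: nbad; by exists (i, s).
have {}[t tP] := choice bad.
pose k p := pi p (t p).1.
have k_inj : injective k by move=> p q /pi_inj[].
have [|||psi psi_inj psiP] := IH (fun p q => a (k p) (k q)) _ (K - delta).
- by move=> *; exact: a0.
- move=> p s us; have [ut it dt] := tP p.
  (* The bad set of row [k p] lies in piece [p], which the transversal meets only at [k p], an index
     outside that set. The two index lists are thus disjoint, and the bad set uses up [delta] of the
     bound [K]. *)
  have := aK (k p) ([seq k q | q <- s] ++ [seq pi p j | j <- (t p).2]).
  rewrite big_cat !big_map /= => H; rewrite lerBrDr.
  apply: le_trans (H _); first by rewrite lerD2l ltW.
  rewrite cat_uniq !map_inj_uniq//; last by move=> i j /pi_inj[].
  rewrite us ut andbT /=; apply/hasPn => _ /mapP[j js ->].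
  apply/mapP => -[q _] /pi_inj[pq ji]; move: it; rewrite pq -ji.
  by rewrite -pq js.
- by rewrite lerBlDr -[X in _ + X]mul1r -mulrDl natr1.
- by exists (k \o psi); [exact: inj_comp|exact: psiP].
Qed.

Section c0_theory.
Context {R : realType}.

Lemma c0_apply_le (u : c0 R) n : `|u n| <= `|u|.
Proof. exact: c0_norm_ub. Qed.

Lemma c0_complete (F : set_system (c0 R)) :
  ProperFilter F -> cauchy F -> cvg F.
Proof.
move=> FF /cauchyP Fc.
have ev_c n : cvg ((u : c0 R) n @[u --> F]).
  apply/cauchy_cvgP/cauchyP => e e0; have [u0 Fu0] := Fc _ e0.
  exists (u0 n); rewrite /fmap /=; near=> u.
  have : `|u0 - u| < e by near: u; move: Fu0; rewrite -ball_normE.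
  rewrite -ball_normE /=; apply: le_lt_trans.
  by rewrite -[u0 n - u n]/((u0 - u) n) c0_apply_le.
pose l n := lim ((u : c0 R) n @[u --> F]).
have lE n : (u : c0 R) n @[u --> F] --> l n by exact: ev_c.
have lF (u0 : c0 R) (e : R) n : F (ball u0 e) -> `|u0 n - l n| <= e.
  move=> Fu0.
  have c : `|u0 n - u n| @[u --> F] --> `|u0 n - l n|.
    by apply: cvg_norm; exact: cvgB (cvg_cst _) (lE n).
  apply: (@closed_cvg _ _ _ FF _ [set y | y <= e] _ _ _ c).
    exact: closed_le.
  near=> u => /=; rewrite -[u0 n - u n]/((u0 - u) n).
  rewrite (le_trans (c0_apply_le _ _))//.
  by apply: ltW; near: u; move: Fu0; rewrite -ball_normE.
have l0 : (l : nat -> R^o) \in @c0_pred R.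
  apply/asboolP/cvgrPdist_le => e e0.
  have [u0 Fu0] := Fc _ (divr_gt0 e0 (ltr0Sn R 1)).
  have /cvgrPdist_le/(_ _ (divr_gt0 e0 (ltr0Sn R 1))) u00 := @c0_cvg R u0.
  near=> n; rewrite sub0r normrN -[l n](subKr (u0 n)).
  rewrite (le_trans (ler_normB _ _))// [e]splitr lerD ?lF//.
  by rewrite -normrN -sub0r; near: n.
apply/cvg_ex; exists (C0 l0); apply/cvgrPdist_le => e e0.
have [u1 Fu1] := Fc _ (divr_gt0 e0 (ltr0Sn R 1)).
near=> h; rewrite -[C0 l0](subrK u1) -addrA (le_trans (ler_normD _ _))//.
rewrite [e]splitr lerD//.
  by rewrite distrC; apply: c0_norm_le => n; exact: (lF u1).
by apply: ltW; near: h; move: Fu1; rewrite -ball_normE.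
Unshelve. all: by end_near. Qed.

HB.instance Definition _ := Uniform_isComplete.Build (c0 R) c0_complete.

(** The lower bound makes preimages of a convergent sequence Cauchy, so completeness of [c0] closes
    the range; it also makes the inverse Lipschitz there. *)
Lemma c0_embeds_bounded_below (X : normedModType R) (T : c0 R -> X) (c C : R) :
  linear T -> 0 < c -> (forall u, c * `|u| <= `|T u|) ->
  (forall u, `|T u| <= C * `|u|) -> c0_embeds X.
Proof.
move=> lT c_gt0 Tc TC.
pose T' : {linear c0 R -> X} := HB.pack T (GRing.isLinear.Build R _ _ _ T lT).
have TB u v : T (u - v) = T u - T v := linearB T' u v.
have cT : continuous T.
  apply/(linear_bounded_continuous T')/bounded_funP => r.
  exists (`|C| * r) => u ur; rewrite (le_trans (TC u))//.
  by rewrite (le_trans (ler_norm _))// normrM normr_id ler_wpM2l.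
have Tinj : injective T.
  move=> u v /eqP; rewrite -subr_eq0 -TB => /eqP uv.
  apply/eqP; rewrite -subr_eq0 -normr_le0.
  by rewrite -(pmulr_rle0 _ c_gt0) (le_trans (Tc _))// uv normr0.
exists (range T).
  split; last first.
    split; first by apply/mem_set; exists 0 => //; exact: (linear0 T').
    move=> a _ _ /set_mem[u _ <-] /set_mem[v _ <-]; apply/mem_set.
    by exists (a *: u + v) => //; exact: lT.
  move=> y yT.
  have yT' e : 0 < e -> exists u, `|y - T u| < e.
    move=> e0; have [_ [[u _ <-]]] := yT _ (nbhsx_ballx y e e0).
    by rewrite -ball_normE; exists u.
  pose e n : R := n.+1%:R^-1.
  have [u uP] := choice (fun n => yT' (e n) (ltac:(by rewrite /e invr_gt0))).
  have uy : T (u n) @[n --> \oo] --> y.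
    apply/cvgrPdist_le => d d0.
    near=> n; rewrite (le_trans (ltW (uP n)))// /e ltW//.
    by near: n; exact: (near_infty_natSinv_lt (PosNum d0)).
  have : cauchy (u @ \oo).
    apply/cauchyP => d d0.
    have cd : 0 < c * d / 2 by rewrite divr_gt0// mulr_gt0.
    have /cvgrPdist_lt/(_ _ cd) uy' := uy.
    near \oo => n; exists (u n).
    near=> m; rewrite -ball_normE /= -(ltr_pM2l c_gt0) (le_lt_trans (Tc _))// TB.
    rewrite -(subrK y (T _)) -addrA (le_lt_trans (ler_normD _ _))//.
    rewrite [ltRHS]splitr ltrD//; last by near: m.
    by rewrite distrC; near: n.
  move=> /cauchy_cvgP/cvg_ex[v uv]; exists v => //.
  apply: (@cvg_unique _ _ (T (u n) @[n --> \oo])) => //.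
  exact: (cvg_comp _ _ uv (cT v)).
pose S y := xget 0 [set u | T u = y].
have TS : cancel T S.
  by move=> u; apply: Tinj; apply: (@xgetPex _ 0 [set v | T v = T u]); exists u.
exists T, S; split => //.
apply/subspace_continuousP => _ [u _ <-]; rewrite /from_subspace TS.
apply/cvgrPdist_le => e e0.
rewrite near_withinE; near=> y => -[v _ vy].
rewrite -vy TS -(ler_pM2l c_gt0) (le_trans (Tc _))// TB vy.
by near: y; apply: cvgr_dist_le => //; exact: mulr_gt0.
Unshelve. all: by end_near. Qed.

End c0_theory.

(** The Bessaga-Pelczynski argument: [rosenthal], applied to norming functionals [g i] of [y i],
    makes the off-diagonal sums of [|g i (y j)|] at most [e / 2], half the lower bound for the
    diagonal. *)
Lemma c0_embeds_wuc (R : realType) (X : completeNormedModType R) (y : nat -> X)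
    (K e : R) :
  0 < e -> (forall n, e <= `|y n|) ->
  (forall (g : dual_space X) s, uniq s -> \sum_(j <- s) `|g (y j)| <= K * `|g|) ->
  c0_embeds X.
Proof.
move=> e_gt0 ye yK.
have K0 : 0 <= K.
  have [g _ gy] := dual_norming (y 0).
  have := yK g [::] isT; rewrite big_nil pmulr_lge0//.
  rewrite normr_gt0; apply: contraTneq (ye 0) => g0.
  by rewrite -gy g0 -ltNge.
have [g gP] : exists g : nat -> dual_space X,
    forall n, `|g n| <= 1 /\ g n (y n) = `|y n|.
  suff /choice[g gP] : forall n, exists g : dual_space X,
      `|g| <= 1 /\ g (y n) = `|y n| by exists g.
  by move=> n; have [h h1 hy] := dual_norming (y n); exists h.
have e2 : 0 < e / 2 by rewrite divr_gt0.
have [|i s us|phi phi_inj phiP] :=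
  @rosenthal R (fun i j => `|g i (y j)|) K (e / 2) _ e2.
- by move=> *; exact: normr_ge0.
- by rewrite (le_trans (yK _ _ us))// ler_piMr// (gP i).1.
pose z n := y (phi n).
have zK (h : dual_space X) s : uniq s -> \sum_(j <- s) `|h (z j)| <= K * `|h|.
  move=> us; rewrite -(big_map phi xpredT (fun j => `|h (y j)|)).
  by apply: yK; rewrite map_inj_uniq.
(* A norming functional of the block reduces this to [zK]. Applied to tails it makes the series
   Cauchy, applied from 0 it bounds [T] above. *)
have block (u : nat -> R) (r : R) m n : (forall k, (m <= k)%N -> `|u k| <= r) ->
    `|\sum_(m <= k < n) u k *: z k| <= K * r.
  move=> ur; have r0 : 0 <= r by rewrite (le_trans _ (ur m _)).
  have [h h1 <-] := dual_norming (\sum_(m <= k < n) u k *: z k).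
  rewrite linear_sum (le_trans (ler_norm _))// (le_trans (ler_norm_sum _ _ _))//.
  apply: (@le_trans _ _ (\sum_(m <= k < n) r * `|h (z k)|)).
    rewrite big_nat_cond [leRHS]big_nat_cond; apply: ler_sum => k.
    by rewrite andbT => /andP[mk _]; rewrite linearZ normrM ler_wpM2r// ur.
  rewrite -mulr_sumr mulrC ler_wpM2r//.
  by rewrite (le_trans (zK _ _ (iota_uniq _ _)))// ler_piMr.
pose S (u : c0 R) := series (fun n => u n *: z n).
have Sc u : cvgn (S u).
  apply/cauchy_cvgP/cauchy_seriesP => d d0.
  have K1 : 0 < K + 1 by rewrite ltr_wpDl.
  have /cvgrPdist_le/(_ _ (divr_gt0 d0 K1)) [N _ uN] := @c0_cvg R u.
  exists ([set n | (N <= n)%N], [set n | (N <= n)%N]).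
    by split; exists N.
  case=> m n [/= Nm Nn].
  apply: (@le_lt_trans _ _ (K * (d / (K + 1)))).
    apply: block => k mk; rewrite -normrN -sub0r.
    exact: uN (leq_trans Nm mk).
  by rewrite mulrCA gtr_pMr// ltr_pdivrMr// mul1r ltrDl.
pose T u := limn (S u).
have ST u : S u @ \oo --> T u by exact: Sc.
apply: (@c0_embeds_bounded_below R X T (e / 2) K) => //.
- move=> a u v; apply: cvg_lim => //.
  have -> : S (a *: u + v) = (fun n => a *: S u n + S v n).
    apply/funext => n; rewrite /S /series /= scaler_sumr -big_split/=.
    by apply: eq_bigr => k _; rewrite scalerA -scalerDl.
  by apply: cvgD => //; exact: cvgZl_tmp.
(* Testing with [g (phi n)]: the diagonal term is at least [e * |u n|] and the others add up to at
   most [e / 2 * |u|]; the supremum over [n] leaves [|T u| >= e / 2 * |u|]. *)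
- move=> u; rewrite -(@ler_pM2l _ 2)//.
  suff : e * `|u| <= `|T u| + e / 2 * `|u|.
    have := normr_ge0 u; nra.
  rewrite -ler_pdivlMl//; apply: c0_norm_le => n; rewrite ler_pdivlMl//.
  rewrite -lerBlDr.
  have cT : `|S u N| @[N --> \oo] --> `|T u| by exact: cvg_norm.
  apply: (@closed_cvg _ _ _ _ _ [set t | e * `|u n| - e / 2 * `|u| <= t] _ _ _ cT).
    exact: closed_ge.
  exists n.+1 => // N /= nN.
  have gS : `|g (phi n) (S u N)| <= `|S u N|.
    by rewrite (le_trans (dual_apply_le _ _))// ler_piMl// (gP _).1.
  apply: le_trans gS; rewrite /S /series /= linear_sum big_mkord.
  rewrite (bigD1 (Ordinal nN))//= [g _ (u n *: _)]linearZ /=.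
  have gz : g (phi n) (z n) = `|z n| := (gP _).2.
  apply: le_trans (lerB_normD _ _). apply: lerB.
    by rewrite gz normrM normr_id mulrC ler_wpM2l// ye.
  rewrite (le_trans (ler_norm_sum _ _ _))// mulrC.
  apply: (@le_trans _ _ (\sum_(i < N | i != Ordinal nN) `|u| * `|g (phi n) (z i)|)).
    by apply: ler_sum => i _; rewrite linearZ normrM ler_wpM2r// c0_apply_le.
  rewrite -mulr_sumr ler_wpM2l//.
  rewrite -(big_mkord (fun i => i != n) (fun i => `|g (phi n) (z i)|)).
  rewrite -big_filter phiP ?filter_uniq ?iota_uniq//.
  by rewrite mem_filter eqxx.
- move=> u; have cT : `|S u N| @[N --> \oo] --> `|T u| by exact: cvg_norm.
  apply: (@closed_cvg _ _ _ _ _ [set t | t <= K * `|u|] _ _ _ cT).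
    exact: closed_le.
  near=> N; apply: block => k _; exact: c0_apply_le.
Unshelve. all: by end_near. Qed.

(** * Existence of Pettis integrals *)

Section strong_measurability.
Context {d : measure_display} {M : measurableType d} {R : realType}.
Variable mu : {measure set M -> \bar R}.

Lemma strongly_measurable_comp (V W : normedModType R) (F : M -> V)
    (Phi : V -> W) :
  continuous Phi -> strongly_measurable mu F -> strongly_measurable mu (Phi \o F).
Proof.
move=> cPhi [mF [S cS SF]]; split.
  move=> U oU; rewrite comp_preimage; apply: mF.
  by apply: open_comp => // t _; exact: cPhi.
exists (Phi @` S); first by apply: card_le_trans cS; exact: card_image_le.
apply: filterS SF => t SFt B /cPhi /SFt[s [Ss Bs]].
by exists (Phi s); split => //; exists s.
Qed.

Lemma strongly_measurable_fun (h : M -> R^o) :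
  strongly_measurable mu h -> measurable_fun setT (h : M -> R).
Proof.
move=> [mh _].
apply: (@measurability _ _ _ _ _ _ (@RGenOpens.G R)); first exact: RGenOpens.measurableE.
move=> _ [_ [a [b ->]] <-]; rewrite setTI; apply: mh.
exact: interval_open.
Qed.

Lemma strongly_measurable_cover (V : normedModType R) (F : M -> V) (delta : R) :
  0 < delta -> strongly_measurable mu F ->
  exists s : nat -> V, {ae mu, forall t, exists k, `|F t - s k| < delta}.
Proof.
move=> d0 [mF [S cS SF]].
have [s Ss] : exists s : nat -> V, S `<=` range s.
  have [->|[f]] := pfcard_geP cS; first by exists (fun=> 0).
  by exists f => v /(@surj _ _ _ _ f).
exists s; apply: filterS SF => t /(_ _ (nbhsx_ballx (F t) delta d0))[v [Sv]].
rewrite -ball_normE /= => Fv; have [k _ kv] := Ss _ Sv.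
by exists k; rewrite kv.
Qed.

End strong_measurability.

Section pettis_existence.
Context {d : measure_display} {M : measurableType d} {R : realType}.
Variable mu : {measure set M -> \bar R}.
Context {V : normedModType R}.
Variable G : M -> V.
Hypothesis mG : strongly_measurable mu G.

Lemma dual_comp_measurable (g : dual_space V) : measurable_fun setT (g \o G : M -> R).
Proof.
apply: (strongly_measurable_fun (mu := mu)).
by apply: strongly_measurable_comp => //; exact: dual_continuous.
Qed.

Lemma dual_comp_integrable (A : set M) (C : R) (g : dual_space V) :
  measurable A -> (mu A < +oo)%E -> (forall t, A t -> `|G t| <= C) ->
  mu.-integrable A (EFin \o (g \o G)).
Proof.
move=> mA Afin GC; apply: measurable_bounded_integrable => //.
  by apply: measurable_funS (dual_comp_measurable g).
exists (`|g| * C); split; first exact: num_real.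
move=> r rC t At /=; rewrite (le_trans _ (ltW rC))//.
by rewrite (le_trans (dual_apply_le _ _))// ler_wpM2l// GC.
Qed.

Lemma measurable_dist (s : V) (delta : R) :
  measurable [set t | `|G t - s| < delta].
Proof.
have -> : [set t | `|G t - s| < delta] = G @^-1` ball s delta.
  by apply/seteqP; split => t /=; rewrite -ball_normE /= distrC.
by apply: mG.1; exact: ball_open.
Qed.

(** The witness is the integral of a simple function, built by peeling off the part of [A] where [G]
    is close to the last centre. The error is uniform over bounded sets of functionals. *)
Lemma pettis_approx_finite (A : set M) (C delta : R) (s : nat -> V) n :
  measurable A -> (mu A < +oo)%E -> (forall t, A t -> `|G t| <= C) ->
  (forall t, A t -> exists2 k, (k < n)%N & `|G t - s k| < delta) ->
  exists z : V, forall g : dual_space V,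
    `|g z - \int[mu]_(t in A) g (G t)| <= `|g| * delta * fine (mu A).
Proof.
elim: n A => [|n IH] A mA Afin AC Acov.
  exists 0 => g; have -> : A = set0.
    by apply/seteqP; split => t // /Acov[].
  by rewrite Rintegral_set0 linear0 subrr normr0 measure0 mulr0.
pose B := [set t | `|G t - s n| < delta].
have mB : measurable B by exact: measurable_dist.
have mAB : measurable (A `&` B) by exact: measurableI.
have mAD : measurable (A `\` B) by exact: measurableD.
have finS D : measurable D -> D `<=` A -> (mu D < +oo)%E.
  by move=> mD DA; rewrite (le_lt_trans _ Afin)// le_measure// inE.
have ABfin := finS _ mAB (@subIsetl _ A B).
have ADfin := finS _ mAD (@subDsetl _ A B).
have [z zP] : exists z : V, forall g : dual_space V,
    `|g z - \int[mu]_(t in A `\` B) g (G t)| <= `|g| * delta * fine (mu (A `\` B)).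
  apply: IH => //; first by move=> t [/AC].
  move=> t [At Bt]; have [k kn Gk] := Acov t At; exists k => //.
  move: kn; rewrite ltnS leq_eqVlt => /predU1P[kn|//].
  by exfalso; apply: Bt; rewrite /B /= -kn.
exists (z + fine (mu (A `&` B)) *: s n) => g.
have igA : mu.-integrable A (EFin \o (g \o G)) by exact: dual_comp_integrable AC.
have igB : mu.-integrable (A `&` B) (EFin \o (g \o G)) by exact: integrableS igA.
have icst (r : R) : mu.-integrable (A `&` B) (EFin \o cst r).
  by apply: measurable_bounded_integrable => //; exact: bounded_cst.
have AE : A = (A `\` B) `|` (A `&` B) by rewrite setUC setUIDK.
have dAB : [disjoint A `\` B & A `&` B].
  by apply/disj_setPS => t [[_ nB] [_ /nB]].
have -> : \int[mu]_(t in A) g (G t) =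
    \int[mu]_(t in A `\` B) g (G t) + \int[mu]_(t in A `&` B) g (G t).
  by rewrite {1}AE Rintegral_setU// -AE.
have -> : fine (mu A) = fine (mu (A `\` B)) + fine (mu (A `&` B)).
  rewrite -fineD ?ge0_fin_numE//; congr fine.
  by rewrite {1}AE measureU//; exact/disj_set2P.
have -> : g (z + fine (mu (A `&` B)) *: s n) =
    g z + \int[mu]_(t in A `&` B) g (s n).
  by rewrite linearD linearZ Rintegral_cst// mulrC.
rewrite opprD addrACA mulrDr (le_trans (ler_normD _ _))//.
apply: lerD => //.
have igd : mu.-integrable (A `&` B) (EFin \o (fun t => g (s n) - g (G t))).
  exact: (integrableB mAB (icst (g (s n))) igB).
rewrite -RintegralB//; last exact: icst.
apply: (le_trans (le_normr_Rintegral _ _)) => //.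
rewrite -Rintegral_cst//; apply: le_Rintegral => //.
- exact: integrable_norm.
- exact: icst.
- move=> t [At Bt]; rewrite -linearB (le_trans (dual_apply_le _ _))//.
  by rewrite ler_wpM2l// distrC ltW.
Qed.

(** Countably many balls cover almost all of [A], so what finitely many of them miss has small
    measure, and there [G] is bounded by [C]. Half of [e] pays for that part, half for the balls;
    the added 1 keeps both denominators positive. *)
Lemma pettis_approx (A : set M) (C e : R) :
  measurable A -> (mu A < +oo)%E -> (forall t, A t -> `|G t| <= C) -> 0 < e ->
  exists z : V, forall g : dual_space V,
    `|g z - \int[mu]_(t in A) g (G t)| <= `|g| * e.
Proof.
move=> mA Afin AC e0.
have mu0 : 0 <= fine (mu A) by rewrite fine_ge0.
pose delta := e / 2 / (fine (mu A) + 1).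
have d0 : 0 < delta by rewrite !divr_gt0// ltr_wpDl.
have [s sG] := strongly_measurable_cover d0 mG.
pose U n := \bigcup_(k in `I_n) [set t | `|G t - s k| < delta].
have mU n : measurable (U n).
  by apply: bigcup_measurable => k _; exact: measurable_dist.
have Dcvg : mu (A `\` U n) @[n --> \oo] --> 0%E.
  have I0 : mu (\bigcap_n (A `\` U n)) = 0%E.
    have [N [mN N0 sN]] := sG.
    apply/eqP; rewrite eq_le measure_ge0 andbT -N0 le_measure ?inE//.
      by apply: bigcapT_measurable => n; exact: measurableD.
    move=> t AU; apply: sN => -[k Gk]; have [_ nU] := AU k.+1 I.
    by apply: nU; exists k => //=.
  rewrite -I0; apply: nonincreasing_cvg_mu => //.
  - rewrite (le_lt_trans _ Afin)// le_measure ?inE//; first exact: measurableD.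
  - by move=> n; exact: measurableD.
  - by apply: bigcapT_measurable => n; exact: measurableD.
  - move=> m n mn; apply/subsetPset => t [At nU]; split => // -[k /= km Gk].
    by apply: nU; exists k => //=; exact: leq_trans mn.
have C1 : 0 < `|C| + 1 by rewrite ltr_wpDl.
pose r := e / 2 / (`|C| + 1).
have r0 : (0 < r%:E)%E by rewrite lte_fin !divr_gt0.
have [n _ /(_ n (leqnn n)) /= An] := Dcvg _ (open_ereal_lt' r0).
have mAU : measurable (A `&` U n) by exact: measurableI.
have mAD : measurable (A `\` U n) by exact: measurableD.
have finS D : measurable D -> D `<=` A -> (mu D < +oo)%E.
  by move=> mD DA; rewrite (le_lt_trans _ Afin)// le_measure// inE.
have ABfin := finS _ mAU (@subIsetl _ A (U n)).
have ADfin := finS _ mAD (@subDsetl _ A (U n)).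
have [z zP] : exists z : V, forall g : dual_space V,
    `|g z - \int[mu]_(t in A `&` U n) g (G t)|
      <= `|g| * delta * fine (mu (A `&` U n)).
  apply: (@pettis_approx_finite _ C delta s n) => //.
    by move=> t [/AC].
  by move=> t [_ [k /= kn Gk]]; exists k.
exists z => g.
have igA : mu.-integrable A (EFin \o (g \o G)) by exact: dual_comp_integrable AC.
have igD : mu.-integrable (A `\` U n) (EFin \o (g \o G)).
  exact: integrableS igA.
have AE : A = (A `\` U n) `|` (A `&` U n) by rewrite setUC setUIDK.
have dAU : [disjoint A `\` U n & A `&` U n].
  by apply/disj_setPS => t [[_ nB] [_ /nB]].
have -> : \int[mu]_(t in A) g (G t) =
    \int[mu]_(t in A `\` U n) g (G t) + \int[mu]_(t in A `&` U n) g (G t).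
  by rewrite {1}AE Rintegral_setU// -AE.
rewrite opprD addrCA addrC (le_trans (ler_normD _ _))//.
rewrite [e]splitr mulrDr lerD//.
  rewrite (le_trans (zP g))// -mulrA ler_wpM2l// /delta mulrAC.
  have Amu : fine (mu (A `&` U n)) <= fine (mu A) + 1.
    rewrite (@le_trans _ _ (fine (mu A)))// ?lerDl//.
    by rewrite fine_le ?ge0_fin_numE// le_measure ?inE.
  by rewrite ler_pdivrMr ?ltr_wpDl// ler_wpM2l// ltW// divr_gt0.
rewrite normrN (le_trans (le_normr_Rintegral _ _))//.
apply: (@le_trans _ _ (\int[mu]_(t in A `\` U n) (`|g| * (`|C| + 1)))).
  apply: le_Rintegral => //.
  - exact: integrable_norm.
  - by apply: measurable_bounded_integrable => //; exact: bounded_cst.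
  - move=> t [At _]; rewrite (le_trans (dual_apply_le _ _))// ler_wpM2l//.
    by rewrite (le_trans (AC _ At))// (le_trans (ler_norm _))// lerDl.
rewrite Rintegral_cst// -mulrA ler_wpM2l// mulrC -ler_pdivlMr// -/r.
by rewrite -lee_fin fineK ?ge0_fin_numE// ltW.
Qed.

End pettis_existence.

(** The approximants are norm Cauchy because their weak error is uniform over the dual unit ball, so
    a norming functional of [z n - z m] can be used. *)
Lemma bounded_has_pettis_integral {d : measure_display} {M : measurableType d}
    {R : realType} (mu : {measure set M -> \bar R})
    (V : completeNormedModType R) (G : M -> V) (A : set M) (C : R) :
  strongly_measurable mu G -> measurable A -> (mu A < +oo)%E ->
  (forall t, A t -> `|G t| <= C) -> exists z, has_pettis_integral mu A G z.
Proof.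
move=> mG mA Afin AC.
have e0 n : 0 < n.+1%:R^-1 :> R by rewrite invr_gt0.
have [z zP] := choice (fun n => pettis_approx mG mA Afin AC (e0 n)).
have : cauchy (z @ \oo).
  apply/cauchyP => d0 d0_gt0.
  have d2 : 0 < d0 / 2 by rewrite divr_gt0.
  near \oo => n; exists (z n).
  suff : \forall m \near \oo, ball (z n) d0 (z m) by [].
  near=> m; rewrite -ball_normE /=.
  have [g g1 <-] := dual_norming (z n - z m).
  rewrite linearB -(subrKA (\int[mu]_(t in A) g (G t))) [ltRHS]splitr.
  rewrite (le_lt_trans (ler_norm _))// (le_lt_trans (ler_normD _ _))// ltrD//.
    rewrite (le_lt_trans (zP n g))// (@le_lt_trans _ _ n.+1%:R^-1)// ?ler_piMl//.
    by near: n; exact: (near_infty_natSinv_lt (PosNum d2)).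
  rewrite distrC (le_lt_trans (zP m g))// (@le_lt_trans _ _ m.+1%:R^-1)// ?ler_piMl//.
  by near: m; exact: (near_infty_natSinv_lt (PosNum d2)).
move=> /cauchy_cvgP/cvg_ex[y zy]; exists y => g; split.
  exact: (dual_comp_integrable mG g mA Afin AC).
have gz : g (z n) @[n --> \oo] --> g y.
  by apply: (cvg_comp _ _ zy); exact: dual_continuous.
rewrite -(cvg_lim (@Rhausdorff R) gz); apply: (cvg_lim (@Rhausdorff R)).
apply/cvgrPdist_le => e e_gt0.
have g1 : 0 < `|g| + 1 by rewrite ltr_wpDl.
near=> n; rewrite distrC (le_trans (zP n g))//.
apply: (@le_trans _ _ ((`|g| + 1) * n.+1%:R^-1)).
  by rewrite ler_wpM2r// lerDl.
rewrite -ler_pdivlMl// ltW// mulrC; near: n.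
exact: (near_infty_natSinv_lt (PosNum (divr_gt0 e_gt0 g1))).
Unshelve. all: by end_near. Qed.

(** * Sign averages in L^1 *)

(** The entry [a] carries the signed sum of the terms already absorbed, from the last index
    downwards, in the averaging over signs. *)
Fixpoint maxabs {R : realDomainType} (w : nat -> R) (a : R) (n : nat) : R :=
  if n is n'.+1 then Num.max (maxabs w a n') `|w n'| else `|a|.

Lemma maxabsE (R : realDomainType) (w : nat -> R) (a : R) n :
  maxabs w a n = Num.max `|a| (maxabs w 0 n).
Proof.
elim: n => [|n IH] /=; first by rewrite normr0; apply/esym/max_idPl.
by rewrite IH maxA.
Qed.

Lemma maxabs_ge0 (R : realDomainType) (w : nat -> R) (a : R) n :
  0 <= maxabs w a n.
Proof. by elim: n => [|n IH] //=; rewrite le_max IH. Qed.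

(** For [b = w n], twice [a] and twice [b] are the sum and the difference of [a + b] and [a - b], so
    both moduli are at most the average of [|a + b|] and [|a - b|]. Averaging over one sign thus
    trades the entry [w n] for a shift of [a]. *)
Lemma maxabs_average (R : realFieldType) (w : nat -> R) (a : R) n :
  maxabs w a n.+1 <= 2^-1 * (maxabs w (a + w n) n + maxabs w (a - w n) n).
Proof.
rewrite /= (maxabsE w a) (maxabsE w (a + _)) (maxabsE w (a - _)).
move: (w n) (maxabs w 0 n) => b m.
have ab : `|a + a| <= `|a + b| + `|a - b|.
  have <- : a + b + (a - b) = a + a by ring.
  exact: ler_normD.
have ba : `|b + b| <= `|a + b| + `|a - b|.
  have <- : a + b - (a - b) = b + b by ring.
  exact: ler_normB.
rewrite -mulr2n normrMn -mulr_natl in ab.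
rewrite -mulr2n normrMn -mulr_natl in ba.
have half (p q r : R) : 2 * r <= p + q -> r <= 2^-1 * (p + q).
  by move=> rpq; rewrite ler_pdivlMl.
have max2 : `|a + b| + `|a - b| <= Num.max `|a + b| m + Num.max `|a - b| m.
  by apply: lerD; rewrite le_max lexx.
rewrite !ge_max -andbA; apply/and3P; split; apply: half.
- exact: le_trans ab max2.
- by rewrite mulr_natl mulr2n lerD// le_max lexx orbT.
- exact: le_trans ba max2.
Qed.

Section L1_null.
Local Open Scope ereal_scope.
Context {d : measure_display} {M : measurableType d} {R : realType}.
Variable mu : {measure set M -> \bar R}.
Variable u : nat -> M -> R.
Hypothesis mu_ : forall k, measurable_fun setT (u k).

Let measurable_maxabs (v : M -> R) n : measurable_fun setT v ->
  measurable_fun setT (fun t => maxabs (u ^~ t) (v t) n).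
Proof.
move=> mv; elim: n => [|n IH] /=; first exact: measurableT_comp.
by apply: measurable_maxr => //; exact: measurableT_comp.
Qed.

(** Each step fixes the sign of the last term and absorbs it in [v]; both choices obey the bound
    [K], hence so does their average. *)
Lemma integral_maxabs_le (K : R) n (v : M -> R) : measurable_fun setT v ->
  (forall s : nat -> bool,
    \int[mu]_t `|v t + \sum_(k < n) (-1) ^+ s k * u k t|%:E <= K%:E) ->
  \int[mu]_t (maxabs (u ^~ t) (v t) n)%:E <= K%:E.
Proof.
elim: n v => [|n IH] v mv sK.
  apply: le_trans (sK (fun=> false)); apply: ge0_le_integral => //.
  - by move=> t _; rewrite lee_fin maxabs_ge0.
  - by apply/measurable_EFinP; exact: measurableT_comp.
  - apply/measurable_EFinP; apply: measurableT_comp => //.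
    by under eq_fun do rewrite big_ord0 addr0.
  - by move=> t _; rewrite big_ord0 addr0.
have half (b : bool) : \int[mu]_t (maxabs (u ^~ t) (v t + (-1) ^+ b * u n t)%R n)%:E
    <= K%:E.
  apply: (IH (fun t => v t + (-1) ^+ b * u n t)%R).
    by apply: measurable_funD => //; exact: measurable_funM.
  move=> s; have := sK (fun k => if k == n then b else s k).
  congr (_ <= _); apply: eq_integral => t _; congr (`|_|%:E).
  rewrite big_ord_recr /= eqxx addrA addrAC; congr (_ + _ + _)%R.
  by apply: eq_bigr => k _; rewrite ltn_eqF.
have mm (b : bool) : measurable_fun setT
    (fun t => (maxabs (u ^~ t) (v t + (-1) ^+ b * u n t)%R n)%:E).
  apply/measurable_EFinP.
  apply: (measurable_maxabs (v := fun t => v t + (-1) ^+ b * u n t)%R).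
  by apply: measurable_funD => //; exact: measurable_funM.
apply: (@le_trans _ _ (\int[mu]_t ((2^-1)%:E *
    ((maxabs (u ^~ t) (v t + (-1) ^+ false * u n t)%R n)%:E +
     (maxabs (u ^~ t) (v t + (-1) ^+ true * u n t)%R n)%:E)))).
  apply: ge0_le_integral => //.
  - by move=> t _; rewrite lee_fin maxabs_ge0.
  - by apply/measurable_EFinP; exact: measurable_maxabs.
  - by apply: measurable_funeM; exact: emeasurable_funD.
  - move=> t _; rewrite -EFinD -EFinM lee_fin expr0 expr1 mul1r mulN1r.
    exact: maxabs_average.
rewrite ge0_integralZl_EFin//; last 2 first.
- by move=> t _; rewrite adde_ge0// lee_fin maxabs_ge0.
- exact: emeasurable_funD.
rewrite ge0_integralD//; try by move=> t _; rewrite lee_fin maxabs_ge0.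
rewrite -[leRHS](_ : (2^-1)%:E * (K%:E + K%:E) = _).
  by rewrite lee_wpmul2l ?leeD// lee_fin invr_ge0.
by rewrite -EFinD -EFinM; congr EFin; field.
Qed.

(* Averaging over signs dominates [\max_k |u k|], so dominated convergence
   applies. *)
Lemma L1_null (K : R) : (forall t, u ^~ t @ \oo --> 0%R) ->
  (forall n (s : nat -> bool),
    \int[mu]_t `|\sum_(k < n) (-1) ^+ s k * u k t|%:E <= K%:E) ->
  \int[mu]_t `|u n t|%:E @[n --> \oo] --> 0.
Proof.
move=> u0 sK.
pose g n t := (maxabs (u ^~ t) 0 n)%:E.
have mg n : measurable_fun setT (g n).
  by apply/measurable_EFinP; apply: (measurable_maxabs (v := cst 0%R)).
have g0 n t : 0 <= g n t by rewrite lee_fin maxabs_ge0.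
have nd_g t : nondecreasing_seq (g^~ t).
  by apply/nondecreasing_seqP => n; rewrite lee_fin /= le_max lexx.
pose S t := limn (g^~ t).
have gS t : g^~ t @ \oo --> S t by exact: ereal_nondecreasing_is_cvgn.
have gleS n t : g n t <= S t.
  by apply: lime_ge; [exact: gS|exists n => // m; exact: nd_g].
have S0 t : 0 <= S t by exact: le_trans (g0 0%N t) (gleS 0%N t).
have mS : measurable_fun setT S by apply: emeasurable_fun_cvg mg _ => t _.
have intS : \int[mu]_t S t <= K%:E.
  rewrite /S monotone_convergence//; apply: lime_le.
    apply: ereal_nondecreasing_is_cvgn => m n mn; apply: ge0_le_integral => //.
    by move=> t _; exact: nd_g.
  apply: nearW => n; apply: (@integral_maxabs_le K n (cst 0%R)) => // s.
  by under eq_integral do rewrite add0r.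
have Sfin t : S t \is a fin_num.
  have /cvg_ex/cvg_seq_bounded[B [_ uB]] : exists l, u^~ t @ \oo --> (l : R^o) by exists 0%R.
  rewrite ge0_fin_numE// (@le_lt_trans _ _ (B + 1)%:E) ?ltry//.
  apply: lime_le => //; apply: nearW => n; rewrite lee_fin.
  have B1 k : (`|u k t| <= B + 1)%R by apply: (uB (B + 1)%R) => //; rewrite ltrDl.
  by elim: n => [|n IH] /=; [rewrite normr0 (le_trans _ (B1 0%N))|rewrite ge_max IH B1].
rewrite -[X in _ --> X](@integral0 _ _ _ mu setT).
apply: (@dominated_cvg _ _ _ mu setT measurableT _ (cst 0) S) => //.
- by move=> n; apply/measurable_EFinP; exact: measurableT_comp.
- by move=> t _; apply: cvg_EFin; [exact: nearW|]; rewrite -(@normr0 _ R); exact: cvg_norm.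
- apply/integrableP; split => //.
  by under eq_integral do rewrite gee0_abs//; rewrite (le_lt_trans intS)// ltry.
- move=> n t _; apply: le_trans (gleS n.+1 t).
  by rewrite lee_fin normr_id /= le_max lexx orbT.
Qed.

End L1_null.

(** * Separation and weakly unconditionally Cauchy sequences *)

Section dual_separation.
Context {R : realType} {V : normedModType R}.
Implicit Types (v w : V) (W : set V).

Lemma bidual_eval v :
  exists2 e : dual_space (dual_space V), forall h, e h = h v & `|e| <= `|v|.
Proof.
have le : linear ((fun h : dual_space V => h v) : dual_space V -> R^o) by [].
have eb (h : dual_space V) : `|h v| <= `|v| * `|h|.
  by rewrite mulrC dual_apply_le.
have [e eE] := linear_bounded_dual le eb.
have eE' h : e h = h v by rewrite eE.
by exists e => //; apply: dual_le_bound => // h; rewrite eE' eb.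
Qed.

(** Hahn-Banach for the distance to [W], a seminorm that vanishes on [W] and is at least [e] at
    [v]. *)
Lemma dual_separation W v (e : R) :
  W 0 -> (forall a u w, W u -> W w -> W (a *: u + w)) ->
  0 < e -> (forall w, W w -> e <= `|v - w|) ->
  exists2 g : dual_space V, forall w, W w -> g w = 0 & g v != 0.
Proof.
move=> W0 Wl e0 eW.
pose A u := [set `|u - w| | w in W].
have A0 u : A u !=set0 by exists `|u - 0|, 0.
have Alb u : lbound (A u) 0 by move=> _ [w _ <-].
have Ai u w : W w -> inf (A u) <= `|u - w|.
  by move=> Ww; apply: ge_inf; [exists 0; exact: Alb|exists w].
have i0 u : 0 <= inf (A u) by exact: lb_le_inf (A0 u) (Alb u).
have iZ a u : inf (A (a *: u)) <= `|a| * inf (A u).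
  have [->|a0] := eqVneq a 0.
    by rewrite scale0r normr0 mul0r (le_trans (Ai _ 0 W0))// subr0 normr0.
  rewrite -ler_pdivrMl ?normr_gt0//; apply: lb_le_inf => // _ [w Ww <-].
  rewrite ler_pdivrMl ?normr_gt0// -normrZ scalerBr Ai//.
  by rewrite -[_ *: w]addr0; exact: Wl.
have [||u|g gp gv] := @dual_seminorm_ex R V (fun u => inf (A u)) 1 v.
- move=> u u'; rewrite -lerBlDl; apply: lb_le_inf => // _ [w Ww <-].
  rewrite lerBlDl -lerBlDr; apply: lb_le_inf => // _ [w' Ww' <-].
  have Ww2 : W (w + w') by rewrite -[w]scale1r; exact: Wl.
  rewrite lerBlDr (le_trans (Ai _ _ Ww2))//.
  by rewrite opprD [- w - _]addrC addrACA ler_normD.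
- move=> a u; apply/eqP; rewrite eq_le iZ /=.
  have [->|a0] := eqVneq a 0; first by rewrite normr0 mul0r.
  rewrite -ler_pdivlMl ?normr_gt0// -normfV (le_trans _ (iZ _ _))//.
  by rewrite scalerA mulVf// scale1r.
- by rewrite mul1r (le_trans (Ai _ 0 W0))// subr0.
exists g.
  move=> w Ww; apply/eqP; rewrite -normr_le0 (le_trans (gp w))//.
  by rewrite (le_trans (Ai _ w Ww))// subrr normr0.
rewrite gv gt_eqF// (lt_le_trans e0)//.
by apply: lb_le_inf => // _ [w Ww <-]; exact: eW.
Qed.

End dual_separation.

(** Banach-Steinhaus on the dual, for evaluations at finite sums with coefficients of modulus at
    most 1; taking the signs of [g (y j)] as coefficients recovers the sum of moduli. *)
Lemma wuc_uniform (R : realType) (X : normedModType R) (y : nat -> X) :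
  (forall g : dual_space X, exists K : R,
    forall s, uniq s -> \sum_(j <- s) `|g (y j)| <= K) ->
  exists K : R, forall (g : dual_space X) s, uniq s ->
    \sum_(j <- s) `|g (y j)| <= K * `|g|.
Proof.
move=> yK.
pose F := [set e : dual_space (dual_space X) | exists s (c : nat -> R),
  [/\ uniq s, forall j, `|c j| <= 1 &
      forall h, e h = h (\sum_(j <- s) c j *: y j)]].
have [|K K0 FK] := @dual_uniform_bounded R (dual_space X) F.
  move=> g; have [K gK] := yK g; exists K => e [s [c [us c1 ->]]].
  rewrite linear_sum (le_trans (ler_norm_sum _ _ _))// (le_trans _ (gK s us))//.
  by apply: ler_sum => j _; rewrite linearZ normrM ler_piMl.
exists K => g s us.
pose c j : R := (-1) ^+ (g (y j) < 0)%R.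
have [e eE _] := bidual_eval (\sum_(j <- s) c j *: y j).
have Fe : F e by exists s, c; split => // j; rewrite normr_sign.
have -> : \sum_(j <- s) `|g (y j)| = e g.
  rewrite eE linear_sum; apply: eq_bigr => j _.
  by rewrite linearZ normrEsign; congr (_ * _).
rewrite (le_trans (ler_norm _))// (le_trans (dual_apply_le _ _))//.
by rewrite ler_wpM2r// FK.
Qed.

(** * Continuous Schauder frames *)

Lemma Rintegral_norm_setT {d : measure_display} {M : measurableType d}
    {R : realType} (mu : {measure set M -> \bar R}) (E : set M) (h : M -> R) :
  measurable E -> mu.-integrable setT (EFin \o h) ->
  \int[mu]_(t in E) `|h t| <= \int[mu]_t `|h t|.
Proof.
move=> mE ih; have ihE : mu.-integrable E (EFin \o h) by exact: integrableS ih.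
apply: fine_le; try exact/integrable_fin_num/integrable_norm.
apply: ge0_subset_integral => //.
by have /integrableP[] := integrable_norm ih.
Qed.

Section frame_theory.
Context {R : realType} {d : measure_display} {M : measurableType d}.
Context {mu : {sigma_finite_measure set M -> \bar R}}.
Context {X : completeNormedModType R} {x : M -> X} {f : M -> dual_space X}.
Hypothesis xf : continuous_schauder_frame mu x f.
Local Notation D := (frame_domain mu x f).
Local Notation J := (fun (G : dual_space (dual_space X)) E =>
  pettis_integral mu E (fun t => G (f t) *: x t)).

(** The maps [G (f t) *: x t], [g (x t) *: f t] and [|f t| * |x t|] are measured as continuous
    images of the pair, which spares a product rule for Banach-valued maps, one of them into a
    possibly non-separable dual. *)
Lemma frame_pair_measurable (W : normedModType R)
    (Phi : X * dual_space X -> W) :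
  continuous Phi -> strongly_measurable mu (fun t => Phi (x t, f t)).
Proof. by move=> cPhi; exact: strongly_measurable_comp xf.1. Qed.

Lemma fst_scale_continuous (G : dual_space (dual_space X)) :
  continuous (fun p : X * dual_space X => G p.2 *: p.1).
Proof.
move=> p; apply: cvgZ; last exact: cvg_fst.
exact: (cvg_comp snd G cvg_snd (dual_continuous (x:=p.2))).
Qed.

Lemma snd_scale_continuous (g : dual_space X) :
  continuous (fun p : X * dual_space X => g p.1 *: p.2).
Proof.
move=> p; apply: cvgZ; last exact: cvg_snd.
exact: (cvg_comp fst g cvg_fst (dual_continuous (x:=p.1))).
Qed.

Lemma frame_domain_measurable E : D E -> measurable E.
Proof. by case. Qed.

Lemma frame_domain0 : D set0.
Proof. by split => //; [rewrite measure0|exists 0]. Qed.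

Lemma frame_domainS A E : D E -> measurable A -> A `<=` E -> D A.
Proof.
move=> [mE fE [C EC]] mA AE; split => //.
  by rewrite (le_lt_trans _ fE)// le_measure ?inE.
by exists C => t /AE; exact: EC.
Qed.

Lemma frame_domainU A B : D A -> D B -> D (A `|` B).
Proof.
move=> [mA fA [C AC]] [mB fB [C' BC]]; split; first exact: measurableU.
  by rewrite (le_lt_trans (measureU2 _ _ _))// lte_add_pinfty.
exists (Num.max C C') => t [/AC|/BC] h; rewrite le_max h ?orbT//.
Qed.

Lemma pettis_integralP (G : dual_space (dual_space X)) E : D E ->
  has_pettis_integral mu E (fun t => G (f t) *: x t) (J G E).
Proof.
move=> [mE fE [C EC]].
apply: (@xgetPex _ 0 [set y | has_pettis_integral mu E (fun t => G (f t) *: x t) y]).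
apply: (@bounded_has_pettis_integral _ _ _ _ _ _ _ (`|G| * C)) => //.
  exact: (@frame_pair_measurable X _ (@fst_scale_continuous G)).
move=> t /EC Ct; rewrite normrZ (le_trans (ler_wpM2r _ (dual_apply_le _ _)))//.
by rewrite -mulrA ler_wpM2l.
Qed.

(* The Pettis integrals over [E] of [g (x t) *: f t] form a subset of the dual
   bounded uniformly in [E]; unlike for [x], the functional [G] can be applied
   to them under the integral sign. *)
Lemma frame_weak_bound (g : dual_space X) : exists2 K : R, 0 <= K &
  forall E (G : dual_space (dual_space X)), D E ->
    `|\int[mu]_(t in E) (G (f t) * g (x t))| <= K * `|G|.
Proof.
pose H t := g (x t) *: f t.
pose F := [set l | exists2 E, D E & has_pettis_integral mu E H l].
have [v|K K0 FK] := @dual_uniform_bounded R X F.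
  have [y yP] := (xf.2 v).1 setT measurableT.
  have [ig _] := yP g.
  have ig' : mu.-integrable setT (EFin \o (fun t => f t v * g (x t))).
    by apply: eq_integrable ig => // t _; rewrite linearZ.
  (* Pettis integrability over all of [M] makes this finite, so one bound at [v] serves every
     [E]. *)
  exists (\int[mu]_t `|f t v * g (x t)|) => l [E DE lP].
  have mE := frame_domain_measurable DE.
  have [e ev _] := bidual_eval v.
  have [_] := lP e; rewrite ev => ->.
  have igE : mu.-integrable E (EFin \o (fun t => f t v * g (x t))).
    exact: integrableS ig'.
  rewrite (@eq_Rintegral _ _ _ mu E (fun t => f t v * g (x t))); last first.
    by move=> t _; rewrite ev mulrC.
  by rewrite (le_trans (le_normr_Rintegral _ _))// Rintegral_norm_setT.
exists K => // E G DE; have [mE fE [C EC]] := DE.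
have [l lP] : exists l, has_pettis_integral mu E H l.
  apply: (@bounded_has_pettis_integral _ _ _ _ _ _ _ (`|g| * C)) => //.
    exact: (@frame_pair_measurable (dual_space X) _ (@snd_scale_continuous g)).
  move=> t /EC Ct; rewrite normrZ (le_trans (ler_wpM2r _ (dual_apply_le _ _)))//.
  by rewrite -mulrA ler_wpM2l// mulrC.
have [_] := lP G; rewrite (@eq_Rintegral _ _ _ mu E (fun t => G (f t) * g (x t))).
  move=> <-; rewrite (le_trans (dual_apply_le _ _))// mulrC ler_wpM2r// FK//.
  by exists E.
by move=> t _; rewrite linearZ mulrC.
Qed.

End frame_theory.

Lemma Rintegral_bigsetU {d : measure_display} {M : measurableType d} {R : realType}
    (mu : {measure set M -> \bar R}) (B : nat -> set M) (h : M -> R) (s : seq nat) :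
  (forall n, measurable (B n)) -> trivIset setT B -> uniq s ->
  mu.-integrable (\big[setU/set0]_(j <- s) B j) (EFin \o h) ->
  \int[mu]_(t in \big[setU/set0]_(j <- s) B j) h t =
  \sum_(j <- s) \int[mu]_(t in B j) h t.
Proof.
move=> mB tB; elim: s => [|j s IH] /=.
  by rewrite !big_nil Rintegral_set0.
move=> /andP[js us]; rewrite !big_cons => ih.
have mU : measurable (\big[setU/set0]_(k <- s) B k) by exact: bigsetU_measurable.
have ihs : mu.-integrable (\big[setU/set0]_(k <- s) B k) (EFin \o h).
  by apply: integrableS ih => //; exact: measurableU.
rewrite Rintegral_setU ?IH//.
apply/disj_setPS => t [Bj]; rewrite -bigcup_seq => -[k ks Bk].
have jk : j = k by apply: tB => //; exists t.
by move: js; rewrite jk ks.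
Qed.

(** * Bounded completeness when c_0 does not embed *)

Section c0_free.
Context {R : realType} {d : measure_display} {M : measurableType d}.
Context {mu : {sigma_finite_measure set M -> \bar R}}.
Context {X : completeNormedModType R} {x : M -> X} {f : M -> dual_space X}.
Hypothesis xf : continuous_schauder_frame mu x f.
Local Notation D := (frame_domain mu x f).

Lemma frame_net_proper : ProperFilter (frame_net mu x f).
Proof.
apply: filter_from_proper; last by move=> E DE; exists E; split.
apply: filter_from_filter; first by exists set0; exact: frame_domain0.
move=> A B DA DB; exists (A `|` B); first exact: frame_domainU.
by move=> E [DE ABE]; split; split => // t ?; apply: ABE; [left|right].
Qed.

(** Finite unions of the disjoint increments stay in the domain, so [frame_weak_bound] bounds all
    finite sums of [g (y j)] by one constant. Splitting by sign passes to moduli at the cost of a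
    factor 2. *)
Lemma increments_wuc (G : dual_space (dual_space X)) (E : nat -> set M)
    (y : nat -> X) :
  (forall n, D (E n)) -> (forall n, E n `<=` E n.+1) ->
  (forall n, has_pettis_integral mu (E n.+1 `\` E n)
    (fun t => G (f t) *: x t) (y n)) ->
  forall g : dual_space X, exists K : R,
    forall s, uniq s -> \sum_(j <- s) `|g (y j)| <= K.
Proof.
move=> DE EE yP g; have [K K0 KP] := frame_weak_bound xf g.
pose B n := E n.+1 `\` E n.
have mE n : measurable (E n) := frame_domain_measurable (DE n).
have mB n : measurable (B n) by exact: measurableD.
have Emono m n : (m <= n)%N -> E m `<=` E n.
  elim: n => [|n IH]; first by rewrite leqn0 => /eqP ->.
  by rewrite leq_eqVlt => /predU1P[->//|/IH/subset_trans]; apply.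
have tB : trivIset setT B.
  apply/trivIsetP => i j _ _; wlog ij : i j / (i < j)%N => [H|_].
    rewrite neq_lt => /orP[ij|ji]; first by apply: H => //; rewrite lt_eqF.
    by rewrite setIC; apply: H => //; rewrite lt_eqF.
  apply/seteqP; split => // t [[Ei _] [_ nEj]]; apply: nEj.
  exact: Emono ij _ Ei.
pose h t := G (f t) * g (x t).
have yE j : g (y j) = \int[mu]_(t in B j) h t.
  have [_ ->] := yP j g; apply: eq_Rintegral => t _.
  by rewrite linearZ.
have bound s : uniq s -> `|\sum_(j <- s) g (y j)| <= K * `|G|.
  move=> us; under eq_bigr do rewrite yE.
  have DU : D (\big[setU/set0]_(j <- s) B j).
    elim: {us} s => [|j s IH]; first by rewrite big_nil; exact: frame_domain0.
    rewrite big_cons; apply: frame_domainU => //.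
    by apply: frame_domainS (DE j.+1) (mB j) _; exact: subDsetl.
  have := KP _ G DU; rewrite Rintegral_bigsetU//.
  have [ih _] := pettis_integralP xf G DU g.
  apply: eq_integrable ih => // [|t _]; last by rewrite linearZ.
  exact: frame_domain_measurable DU.
exists (K * `|G| + K * `|G|) => s us.
rewrite (bigID (fun j => 0 <= g (y j))) /=.
rewrite -[X in X + _]big_filter -[X in _ + X]big_filter lerD//.
  apply: le_trans (bound _ (filter_uniq (fun j => 0 <= g (y j)) us)).
  rewrite (le_trans _ (ler_norm _))// big_seq [leRHS]big_seq.
  by apply: ler_sum => j; rewrite mem_filter => /andP[gj _]; rewrite ger0_norm.
apply: le_trans (bound _ (filter_uniq (fun j => ~~ (0 <= g (y j))) us)).
rewrite -normrN (le_trans _ (ler_norm _))// -sumrN big_seq [leRHS]big_seq.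
apply: ler_sum => j; rewrite mem_filter -ltNge => /andP[gj _].
by rewrite ltr0_norm.
Qed.

Lemma c0_free_boundedly_complete : ~ c0_embeds X -> boundedly_complete mu x f.
Proof.
move=> nc0 G; have FF := frame_net_proper.
pose I E := pettis_integral mu E (fun t => G (f t) *: x t).
apply/cvg_ex/cauchy_cvgP/cauchyP => e e0.
apply: contrapT => nE; apply: nc0.
(* Otherwise the tail of the net above [E0] would stay within [e] of [I E0]. Iterating from the
   empty set gives an increasing sequence, whose successive differences are the disjoint sets. *)
have step E0 : exists E, D E0 -> [/\ D E, E0 `<=` E & e <= `|I E - I E0|].
  have [DE0|] := pselect (D E0); last by exists set0.
  apply: contrapT => nE'; apply: nE; exists (I E0); exists E0 => // E [DE E0E].
  rewrite /= -ball_normE /= distrC ltNge; apply/negP => eE.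
  by apply: nE'; exists E.
have [nxt nxtP] := choice step.
pose E n := iter n nxt set0.
have DE n : D (E n).
  by elim: n => [|n IH]; [exact: frame_domain0|case: (nxtP _ IH)].
have EE n : E n `<=` E n.+1 by have [] := nxtP _ (DE n).
pose y n := I (E n.+1) - I (E n).
have yP n : has_pettis_integral mu (E n.+1 `\` E n)
    (fun t => G (f t) *: x t) (y n).
  have mE k : measurable (E k) by exact: frame_domain_measurable (DE k).
  have mB : measurable (E n.+1 `\` E n) by exact: measurableD.
  move=> g; have [i1 e1] := pettis_integralP xf G (DE n.+1) g.
  have [i0 e0'] := pettis_integralP xf G (DE n) g.
  split; first exact: integrableS i1.
  have EU : E n.+1 = (E n.+1 `\` E n) `|` E n by rewrite setUC setDUK.
  rewrite /y linearB /I /= e1 e0' {1}EU Rintegral_setU ?addrK// -?EU//.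
  by apply/disj_setPS => t [[_ nB] /nB].
have [K yK] := wuc_uniform (increments_wuc DE EE yP).
apply: (@c0_embeds_wuc R X y K e) => // n.
by have [] := nxtP _ (DE n).
Qed.

End c0_free.

(** * Finitely supported sequences *)

Section c0_finite.
Context {R : realType}.
Implicit Types (a b : nat -> R) (n : nat).

Lemma c0_fin_subproof a n :
  ((fun k => if (k < n)%N then a k else 0) : nat -> R^o) \in @c0_pred R.
Proof.
apply/asboolP/cvgrPdist_le => e e0; near=> k.
by rewrite ifF ?subrr ?normr0 ?ltW//; apply/negbTE; rewrite -leqNgt; near: k; exists n.
Unshelve. all: by end_near. Qed.

Definition c0_fin a n : c0 R := C0 (c0_fin_subproof a n).

Lemma c0_finE a n k : c0_fin a n k = if (k < n)%N then a k else 0.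
Proof. by []. Qed.

Lemma c0_ext (u v : c0 R) : (forall k, u k = v k) -> u = v.
Proof. by move=> uv; apply/val_inj/funext. Qed.

Lemma c0_addE (u v : c0 R) k : (u + v) k = u k + v k. Proof. by []. Qed.

Lemma c0_subE (u v : c0 R) k : (u - v) k = u k - v k. Proof. by []. Qed.

Lemma c0_scaleE (r : R) (u : c0 R) k : (r *: u) k = r * u k. Proof. by []. Qed.

Lemma c0_le_bound (u : c0 R) (r : R) : (forall k, `|u k| <= r) -> `|u| <= r.
Proof. exact: c0_norm_le. Qed.

Definition c0_unit n : c0 R := c0_fin (fun k => (k == n)%:R) n.+1.

Lemma c0_fin0 a : c0_fin a 0 = 0.
Proof. exact: c0_ext. Qed.

Lemma c0_finS a n : c0_fin a n.+1 = c0_fin a n + a n *: c0_unit n.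
Proof.
apply: c0_ext => k; rewrite c0_addE c0_scaleE !c0_finE ltnS leq_eqVlt.
by case: ltngtP => [||->]; rewrite /= ?(mulr0, mulr1, add0r, addr0).
Qed.

Lemma c0_fin_norm a n : (forall k, `|a k| <= 1) -> `|c0_fin a n| <= 1.
Proof.
move=> a1; apply: c0_le_bound => k; rewrite c0_finE.
by case: ifP => // _; rewrite normr0.
Qed.

End c0_finite.

Section c0_operator.
Context {R : realType} {X : normedModType R}.
Variables (T : {linear c0 R -> X}) (C : R).
Hypothesis TC : forall u, `|T u| <= C * `|u|.

Lemma c0_operator_bound_ge0 : 0 <= C.
Proof.
have u0 : 0 < `|c0_unit 0 : c0 R|.
  apply: (@lt_le_trans _ _ `|(c0_unit 0 : c0 R) 0|); last exact: c0_apply_le.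
  by rewrite c0_finE /= normr1.
by rewrite -(pmulr_lge0 _ u0) (le_trans _ (TC _)).
Qed.

Lemma dual_c0_fin (h : dual_space X) (a : nat -> R) n :
  h (T (c0_fin a n)) = \sum_(k < n) a k * h (T (c0_unit k)).
Proof.
elim: n => [|n IH]; first by rewrite big_ord0 c0_fin0 !linear0.
by rewrite big_ord_recr /= -IH c0_finS !linearD !linearZ.
Qed.

(** Testing [h] on [T (c0_fin a n)] with [a k] the sign of [h (T (c0_unit k))] shows that the series
    of these values converges absolutely. The weak* limit therefore exists along the full sequence,
    with no subnet to extract. *)
Lemma c0_operator_bidual : exists G : dual_space (dual_space X),
  forall h : dual_space X, h (T (c0_fin (fun=> 1) n)) @[n --> \oo] --> G h.
Proof.
have C0 := c0_operator_bound_ge0.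
have hb (h : dual_space X) a n : (forall k, `|a k| <= 1) ->
    `|h (T (c0_fin a n))| <= C * `|h|.
  move=> a1; rewrite mulrC (le_trans (dual_apply_le _ _))// ler_wpM2l//.
  by rewrite (le_trans (TC _))// ler_piMr// c0_fin_norm.
have one1 (k : nat) : `|1 : R| <= 1 by rewrite normr1.
have hc (h : dual_space X) : cvg (h (T (c0_fin (fun=> 1) n)) @[n --> \oo]).
  have -> : (fun n => h (T (c0_fin (fun=> 1) n))) = series (fun k => h (T (c0_unit k))).
    apply/funext => n; rewrite dual_c0_fin /series /= big_mkord.
    by apply: eq_bigr => k _; rewrite mul1r.
  apply: normed_cvg; apply: nondecreasing_is_cvgn.
    apply/nondecreasing_seqP => n.
    by rewrite -subr_ge0 [X in _ <= X](_ : _ = `|h (T (c0_unit n))|)//; exact: seriesSB.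
  exists (C * `|h|) => _ [n _ <-].
  rewrite [leLHS](_ : _ = \sum_(k < n) `|h (T (c0_unit k))|); last exact: big_mkord.
  pose a k : R := (-1) ^+ (h (T (c0_unit k)) < 0)%R.
  apply: le_trans (hb h a n _); last by move=> k; rewrite normr_sign.
  rewrite dual_c0_fin (le_trans _ (ler_norm _))// le_eqVlt; apply/orP; left.
  by apply/eqP/eq_bigr => k _; rewrite normrEsign.
pose G (h : dual_space X) : R^o := lim (h (T (c0_fin (fun=> 1) n)) @[n --> \oo]).
have GP (h : dual_space X) : h (T (c0_fin (fun=> 1) n)) @[n --> \oo] --> G h.
  exact: hc.
have lG : linear G.
  move=> r h h'; apply: cvg_lim => //.
  exact: cvgD (cvgZl_tmp (GP h)) (GP h').
have [G' G'E] : exists G' : dual_space (dual_space X), (G' : _ -> R^o) = G.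
  apply: (@linear_bounded_dual _ _ _ C) => // h.
  have c : `|h (T (c0_fin (fun=> 1) n))| @[n --> \oo] --> `|G h| by exact: cvg_norm.
  apply: (@closed_cvg _ _ _ _ _ [set t | t <= C * `|h|] _ _ _ c).
    exact: closed_le.
  by apply: nearW => n /=; exact: hb.
by exists G' => h; rewrite G'E.
Qed.

End c0_operator.

(** * Weak integrals over the whole space *)

Lemma Rintegral_exhaust {d : measure_display} {M : measurableType d} {R : realType}
    (mu : {measure set M -> \bar R}) (B : nat -> set M) (h : M -> R) :
  (forall n, measurable (B n)) -> (forall t, \forall n \near \oo, B n t) ->
  mu.-integrable setT (EFin \o h) ->
  \int[mu]_(t in B n) h t @[n --> \oo] --> \int[mu]_t h t.
Proof.
move=> mB Bt ih; apply: fine_cvg; rewrite fineK ?integrable_fin_num//.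
under eq_fun do rewrite integral_mkcond.
have /integrableP[mh _] := ih.
apply: (@dominated_cvg _ _ _ mu setT measurableT _ _ (fun t => `|h t|%:E)) => //.
- move=> n; apply/(measurable_restrictT _ (mB n)).1.
  exact: measurable_funS mh.
- move=> t _; apply: cvg_near_cst; near=> n.
  by rewrite patchE ifT//; apply/mem_set; near: n.
- exact: integrable_norm.
- by move=> n t _; rewrite patchE; case: ifP => // _; rewrite abse0 lee_fin.
Unshelve. all: by end_near. Qed.

Section frame_weak_integral.
Context {R : realType} {d : measure_display} {M : measurableType d}.
Context {mu : {sigma_finite_measure set M -> \bar R}}.
Context {X : completeNormedModType R} {x : M -> X} {f : M -> dual_space X}.
Hypothesis xf : continuous_schauder_frame mu x f.
Local Notation D := (frame_domain mu x f).

(** The pieces [F i] need not be nested, hence the finite unions; cutting them by the level set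
    [B n], which grows with [n], puts them in the domain and still captures each [t] eventually. *)
Lemma frame_domain_exhaust : exists2 A : nat -> set M,
  forall n, D (A n) & forall t, \forall n \near \oo, A n t.
Proof.
have [F FT Ffin] := sigma_finiteT mu.
pose B n := [set t | `|f t| * `|x t| <= n%:R].
have mB n : measurable (B n).
  pose Phi (p : X * dual_space X) : R^o := `|p.2| * `|p.1|.
  have cPhi : continuous Phi.
    by move=> p; apply: cvgM; apply: cvg_norm; [exact: cvg_snd|exact: cvg_fst].
  have [mPhi _] := @frame_pair_measurable _ _ _ _ _ _ _ xf R^o Phi cPhi.
  have -> : B n = ~` ((fun t => Phi (x t, f t)) @^-1` [set r | n%:R < r]).
    by apply/seteqP; split => t /=; rewrite /B /Phi /= leNgt => /negP.
  by apply: measurableC; apply: mPhi; exact: open_gt.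
exists (fun n => \big[setU/set0]_(i < n) (F i `&` B n)).
  move=> n; elim/big_ind : _ => [| |i _].
  - exact: frame_domain0.
  - by move=> *; exact: frame_domainU.
  - have [mF fF] := Ffin i; split; first exact: measurableI.
    + by rewrite (le_lt_trans _ fF)// le_measure ?inE//; exact: measurableI.
    + by exists n%:R => t [].
move=> t; have : setT t by [].
rewrite FT => -[i _ Fit]; pose k := (Num.truncn (`|f t| * `|x t|)).+1.
exists (maxn i.+1 k) => // n /=; rewrite geq_max => /andP[ni kn].
rewrite -(bigcup_mkord n (fun i => F i `&` B n)); exists i => //; split => //; rewrite /B /=.
by rewrite (le_trans (ltW (truncnS_gt _)))// ler_nat.
Qed.

Lemma frame_integral (g : dual_space X) v :
  mu.-integrable setT (EFin \o (fun t => f t v * g (x t))) /\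
  g v = \int[mu]_t (f t v * g (x t)).
Proof.
have [pv vE] := xf.2 v.
have [y yP] := pv setT measurableT.
have : has_pettis_integral mu setT (fun t => f t v *: x t) v.
  rewrite {2}vE.
  pose P z := has_pettis_integral mu setT (fun t => f t v *: x t) z.
  by apply: (@xgetPex _ 0 [set z | P z]); exists y.
move=> /(_ g)[ig ->]; split.
  by apply: eq_integrable ig => // t _; rewrite linearZ.
by apply: eq_Rintegral => t _; rewrite linearZ.
Qed.

(** Evaluation at [v], taken as the functional in [frame_weak_bound], controls the integrals over
    the domain; cutting along the sign of the integrand doubles the constant, and an exhaustion
    reaches all of [M]. The gain over mere integrability is the linear dependence on [|v|]. *)
Lemma frame_L1_bound (g : dual_space X) : exists2 K : R, 0 <= K &
  forall v, \int[mu]_t `|f t v * g (x t)| <= K * `|v|.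
Proof.
have [K K0 KP] := frame_weak_bound xf g.
exists (K + K); first by rewrite addr_ge0.
move=> v; have [ih _] := frame_integral g v.
set h := fun t => f t v * g (x t) in ih *.
have mh : measurable_fun setT h by have /integrableP[/measurable_EFinP] := ih.
have [e ev ele] := bidual_eval v.
have hK E : D E -> `|\int[mu]_(t in E) h t| <= K * `|v|.
  move=> DE; apply: (@le_trans _ _ (K * `|e|)); last by rewrite ler_wpM2l.
  by under eq_Rintegral do rewrite /h -ev; exact: KP.
have absK E : D E -> \int[mu]_(t in E) `|h t| <= (K + K) * `|v|.
  move=> DE; have mE := frame_domain_measurable DE.
  pose P := h @^-1` [set r | 0 <= r].
  have mP : measurable P.
    rewrite -[P]setTI; apply: mh => //.
    have -> : [set r : R | 0 <= r] = `[0, +oo[%classic.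
      by apply/seteqP; split => r /=; rewrite in_itv /= andbT.
    exact: measurable_itv.
  have mI := measurableI _ _ mE mP; have mD := measurableD mE mP.
  have inh : mu.-integrable E (EFin \o (fun t => `|h t|)).
    by apply: integrable_norm; exact: integrableS ih.
  rewrite -(setUIDK E P) in inh *.
  rewrite Rintegral_setU//; last by apply/disj_setPS => t [[_ ?] []].
  rewrite mulrDl lerD//.
    rewrite (le_trans _ (hK _ (frame_domainS DE mI (@subIsetl _ _ _))))//.
    rewrite (le_trans _ (ler_norm _))// le_eqVlt; apply/orP; left; apply/eqP.
    by apply: eq_Rintegral => t /set_mem[_ Pt]; rewrite ger0_norm.
  rewrite (le_trans _ (hK _ (frame_domainS DE mD (@subDsetl _ _ _))))//.
  rewrite -normrN (le_trans _ (ler_norm _))// le_eqVlt; apply/orP; left; apply/eqP.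
  rewrite -mulN1r -RintegralZl//; last exact: integrableS ih.
  apply: eq_Rintegral => t /set_mem[_ /negP]; rewrite -ltNge mulN1r => ht.
  by rewrite ltr0_norm.
have [A DA At] := frame_domain_exhaust.
have c := Rintegral_exhaust (fun n => frame_domain_measurable (DA n)) At (integrable_norm ih).
apply: (@closed_cvg _ _ _ _ _ [set r | r <= (K + K) * `|v|] _ _ _ c).
  exact: closed_le.
by apply: nearW => n; exact: absK (DA n).
Qed.

End frame_weak_integral.

Lemma Rintegral_bounded_cvg {d : measure_display} {M : measurableType d}
    {R : realType} (mu : {measure set M -> \bar R}) (E : set M)
    (h_ : nat -> M -> R) (h : M -> R) (B : R) :
  measurable E -> (mu E < +oo)%E -> (forall n, measurable_fun E (h_ n)) ->
  (forall n t, E t -> `|h_ n t| <= B) ->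
  (forall t, E t -> h_ n t @[n --> \oo] --> h t) ->
  \int[mu]_(t in E) h_ n t @[n --> \oo] --> \int[mu]_(t in E) h t.
Proof.
move=> mE fE mh hB hc.
have mh' : measurable_fun E h by exact: measurable_fun_cvg mh hc.
have iB : mu.-integrable E (EFin \o cst B).
  by apply: measurable_bounded_integrable => //; exact: bounded_cst.
have ih : mu.-integrable E (EFin \o h).
  apply: measurable_bounded_integrable => //; exists B; split; first exact: num_real.
  move=> r Br t Et /=; rewrite (le_trans _ (ltW Br))//.
  have c : `|h_ n t| @[n --> \oo] --> `|h t| by apply: cvg_norm; exact: hc.
  apply: (@closed_cvg _ _ _ _ _ [set r | r <= B] _ _ _ c); first exact: closed_le.
  by apply: nearW => n /=; exact: hB.
apply: fine_cvg; rewrite fineK ?integrable_fin_num//.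
apply: (@dominated_cvg _ _ _ mu E mE _ _ (EFin \o cst B)) => //.
- by move=> n; exact/measurable_EFinP.
- by move=> t Et; apply: cvg_EFin; [exact: nearW|exact: hc].
Qed.

(** * A copy of c_0 contradicts bounded completeness *)

Section c0_obstruction.
Context {R : realType} {d : measure_display} {M : measurableType d}.
Context {mu : {sigma_finite_measure set M -> \bar R}}.
Context {X : completeNormedModType R} {x : M -> X} {f : M -> dual_space X}.
Hypothesis xf : continuous_schauder_frame mu x f.
Local Notation D := (frame_domain mu x f).
Variables (T : {linear c0 R -> X}) (C : R).
Hypothesis TC : forall u, `|T u| <= C * `|u|.

Let w n := T (c0_fin (fun=> 1) n).

Let C_ge0 : 0 <= C := c0_operator_bound_ge0 TC.

Let w_bound n : `|w n| <= C.
Proof. by rewrite (le_trans (TC _))// ler_piMr// c0_fin_norm// => k; rewrite normr1. Qed.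

Let w_cvg (h : dual_space X) : cvg (h (w n) @[n --> \oo]).
Proof. by have [G GP] := c0_operator_bidual TC; apply/cvg_ex; exists (G h); exact: GP. Qed.

(** The blocks are images of indicators of disjoint intervals, whose signed sums have supremum norm
    at most 1. *)
Lemma signed_blocks_norm (m n : nat -> nat) (s : nat -> bool) j :
  (forall k, (m k <= n k)%N) -> (forall k, (n k <= m k.+1)%N) ->
  `|\sum_(k < j) (-1) ^+ s k *: (w (n k) - w (m k))| <= C.
Proof.
move=> mn nm.
pose b k : c0 R := c0_fin (fun=> 1) (n k) - c0_fin (fun=> 1) (m k).
have bE k i : b k i = (m k <= i < n k)%:R.
  rewrite /b c0_subE !c0_finE.
  case: (ltnP i (n k)) => ni; case: (ltnP i (m k)) => mi //=; rewrite ?(subrr, subr0)//.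
  by have := leq_trans (leq_trans mi (mn k)) ni; rewrite ltnn.
have -> : \sum_(k < j) (-1) ^+ s k *: (w (n k) - w (m k)) =
    T (\sum_(k < j) (-1) ^+ s k *: b k).
  have bT k : T (b k) = w (n k) - w (m k) by exact: linearB.
  by rewrite linear_sum; apply: eq_bigr => k _; rewrite linearZ /= bT.
rewrite (le_trans (TC _))// ler_piMr//; apply: c0_le_bound => i.
(* The induction also records that the partial sum vanishes from [m j] on, so that the next block
   meets only zeros. *)
suff : `|(\sum_(k < j) (-1) ^+ s k *: b k) i| <= 1 /\
    ((m j <= i)%N -> (\sum_(k < j) (-1) ^+ s k *: b k) i = 0) by case.
elim: j => [|j [IH1 IH2]]; first by rewrite big_ord0; split => //; rewrite normr0.
rewrite big_ord_recr c0_addE c0_scaleE bE; split.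
  have [mji|mji] := leqP (m j) i.
    by rewrite IH2// add0r normrM normr_sign mul1r ger0_norm// lern1; case: ltnP.
  by rewrite /= mulr0 addr0.
move=> mi; have ni : (n j <= i)%N by exact: leq_trans (nm j) mi.
by rewrite IH2 ?(leq_trans (mn j))// ltnNge ni andbF mulr0 addr0.
Qed.

(** Were it false, there would be successive blocks of L^1 mass above [e]. Their signed sums have
    L^1 norm at most [K * C], and they tend to 0 pointwise because [f t (w n)] converges, so
    [L1_null] applies. *)
Lemma block_L1_cauchy (g : dual_space X) (e : R) : 0 < e ->
  exists N, forall m n, (N <= m <= n)%N ->
    \int[mu]_t `|f t (w n - w m) * g (x t)| <= e.
Proof.
move=> e0; apply: contrapT => nN.
have bad N : exists mn : nat * nat, [/\ (N <= mn.1)%N, (mn.1 <= mn.2)%N &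
    e < \int[mu]_t `|f t (w mn.2 - w mn.1) * g (x t)|].
  apply: contrapT => nbad; apply: nN; exists N => m n /andP[Nm mn].
  by rewrite leNgt; apply/negP => emn; apply: nbad; exists (m, n).
have [c cP] := choice bad.
(* Restarting beyond the right end of the previous block makes the blocks disjoint and drives their
   left ends to infinity. *)
pose p := fix p k := if k is k'.+1 then c (p k').2.+1 else c 0%N.
have p12 k : ((p k).1 <= (p k).2)%N by case: k => [|k]; [case: (cP 0)|case: (cP (p k).2.+1)].
have p21 k : ((p k).2 <= (p k.+1).1)%N by rewrite /=; case: (cP (p k).2.+1) => /ltnW.
have pe k : e < \int[mu]_t `|f t (w (p k).2 - w (p k).1) * g (x t)|.
  by case: k => [|k]; [case: (cP 0)|case: (cP (p k).2.+1)].
have [K K0 KP] := frame_L1_bound xf g.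
pose u k t : R := f t (w (p k).2 - w (p k).1) * g (x t).
have iu v : mu.-integrable setT (EFin \o (fun t => f t v * g (x t))).
  by have [] := frame_integral xf g v.
have p1k k : (k <= (p k).1)%N.
  elim: k => // k IH; rewrite (leq_ltn_trans IH)// (leq_ltn_trans (p12 k))//.
  by rewrite /=; case: (cP (p k).2.+1).
have ucvg : (\int[mu]_t `|u n t|%:E)%E @[n --> \oo] --> 0%E.
  apply: (@L1_null _ _ _ mu u _ (K * C)).
  - by move=> k; have /integrableP[/measurable_EFinP] := iu (w (p k).2 - w (p k).1).
  - move=> t; have [l wl] := (cvg_ex _).1 (w_cvg (h := f t)).
    have wq (q : nat -> nat) : (forall k, (k <= q k)%N) ->
        f t (w (q k)) @[k --> \oo] --> l.
      move=> kq; apply: (cvg_comp q (fun n => f t (w n)) _ wl).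
      by apply/cvgnyPge => A; exists A => // k /= Ak; exact: leq_trans (kq k).
    rewrite -[X in _ --> X](mul0r (g (x t))) -(subrr l).
    apply: cvgM; last exact: cvg_cst.
    under eq_fun do rewrite linearB.
    apply: cvgB; last exact: wq.
    by apply: wq => k; exact: leq_trans (p12 k).
  - move=> n s; pose v := \sum_(k < n) (-1) ^+ s k *: (w (p k).2 - w (p k).1).
    have vE t : \sum_(k < n) (-1) ^+ s k * u k t = f t v * g (x t).
      rewrite /v linear_sum mulr_suml; apply: eq_bigr => k _.
      by rewrite linearZ -mulrA.
    under eq_integral do rewrite vE.
    rewrite -[leLHS]fineK; last exact/integrable_fin_num/integrable_norm/iu.
    rewrite lee_fin (le_trans (KP v))// ler_wpM2l//.
    exact: (signed_blocks_norm s n p12 p21).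
have e0E : (0 < e%:E)%E by rewrite lte_fin.
have [k _ /(_ k (leqnn k)) /=] := ucvg _ (open_ereal_lt' e0E).
apply/negP; rewrite -leNgt.
rewrite -[leRHS]fineK; last exact/integrable_fin_num/integrable_norm/iu.
by rewrite lee_fin ltW// pe.
Qed.

(* On each [E] of the domain, [int_E f t (w n) * g (x t)] tends to [g] of the
   Pettis integral, within [e / 3] from an index [N] independent of [E]; this
   exchanges the limits in [n] and along the net. *)
Lemma frame_net_limit (g : dual_space X) (G : dual_space (dual_space X)) (y : X) :
  (forall h : dual_space X, h (w n) @[n --> \oo] --> G h) ->
  pettis_integral mu E (fun t => G (f t) *: x t) @[E --> frame_net mu x f] --> y ->
  g (w n) @[n --> \oo] --> g y.
Proof.
move=> wG Iy; have FF : ProperFilter (frame_net mu x f) := frame_net_proper.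
apply/cvgrPdist_le => e e0.
have e3 : 0 < e / 3 by rewrite divr_gt0.
have [N NP] := block_L1_cauchy g e3.
have gI : g (pettis_integral mu E (fun t => G (f t) *: x t))
    @[E --> frame_net mu x f] --> g y.
  by apply: (cvg_comp _ g Iy); exact: dual_continuous.
have /cvgrPdist_le/(_ _ e3) [E0 DE0 E0P] := gI.
have ih v : mu.-integrable setT (EFin \o (fun t => f t v * g (x t))).
  by have [] := frame_integral xf g v.
have w_limit E m : D E -> (N <= m)%N ->
    `|g (pettis_integral mu E (fun t => G (f t) *: x t)) -
      \int[mu]_(t in E) (f t (w m) * g (x t))| <= e / 3.
  move=> DE Nm; have mE := frame_domain_measurable DE.
  have [_ ig] := pettis_integralP xf G DE g.
  have c : `|\int[mu]_(t in E) (f t (w n) * g (x t)) -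
             \int[mu]_(t in E) (f t (w m) * g (x t))| @[n --> \oo] -->
      `|g (pettis_integral mu E (fun t => G (f t) *: x t)) -
        \int[mu]_(t in E) (f t (w m) * g (x t))|.
    apply: cvg_norm; apply: cvgB; last exact: cvg_cst.
    have [mE' fE [B EB]] := DE;  rewrite ig.
    apply: (@Rintegral_bounded_cvg _ _ _ mu E
      (fun n t => f t (w n) * g (x t)) _ (C * `|g| * B)) => //.
    - move=> n; apply: measurable_funS (_ : measurable_fun setT _) => //.
      by have /integrableP[/measurable_EFinP] := ih (w n).
    - move=> n t Et; rewrite normrM.
      apply: (@le_trans _ _ ((`|f t| * C) * (`|g| * `|x t|))).
        apply: ler_pM => //; last exact: dual_apply_le.
        by rewrite (le_trans (dual_apply_le _ _))// ler_wpM2l.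
      rewrite [X in X * _]mulrC mulrACA ler_wpM2l ?mulr_ge0// EB//.
    - by move=> t Et; rewrite linearZ; apply: cvgM; [exact: wG|exact: cvg_cst].
  apply: (@closed_cvg _ _ _ _ _ [set r | r <= e / 3] _ _ _ c).
    exact: closed_le.
  exists m => // n /= mn.
  have ihE v : mu.-integrable E (EFin \o (fun t => f t v * g (x t))).
    exact: integrableS (ih v).
  rewrite -RintegralB//.
  under eq_Rintegral do rewrite -mulrBl -linearB.
  apply: (le_trans (le_normr_Rintegral _ (ihE _))) => //.
  apply: le_trans (NP m n _); last by rewrite Nm.
  exact: Rintegral_norm_setT.
exists N => // m /= Nm.
(* Adjoining [E0] keeps the exhausting sets in the tail where the net is controlled, while the
   integrals over them still tend to [g (w m)]; one such set serves all three thirds of [e]. *)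
have [A DA At] := frame_domain_exhaust xf.
have DB n : D (E0 `|` A n) by exact: frame_domainU.
have Bt t : \forall n \near \oo, (E0 `|` A n) t.
  by apply: filterS (At t) => n; right.
have := Rintegral_exhaust (fun n => frame_domain_measurable (DB n)) Bt (ih (w m)).
rewrite -(frame_integral xf g (w m)).2 => /cvgrPdist_le/(_ _ e3)[k _ /(_ k (leqnn k)) /=] gw.
have := E0P _ (conj (DB k) (@subsetUl _ E0 (A k))) => /= gE.
have := w_limit _ m (DB k) Nm => gIE.
rewrite (_ : e = e / 3 + e / 3 + e / 3); last by field.
rewrite -(subrKA (g (pettis_integral mu (E0 `|` A k) (fun t => G (f t) *: x t)))).
rewrite (le_trans (ler_normD _ _))// -addrA lerD//.
rewrite -(subrKA (\int[mu]_(t in E0 `|` A k) (f t (w m) * g (x t)))).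
by rewrite (le_trans (ler_normD _ _))// lerD// distrC.
Qed.

Lemma c0_not_bounded_below (c : R) : boundedly_complete mu x f ->
  0 < c -> ~ (forall u, c * `|u| <= `|T u|).
Proof.
move=> bc c_gt0 Tc; have [G wG] := c0_operator_bidual TC.
have [y Iy] := bc G.
have wy g := frame_net_limit (g := g) wG Iy.
have approx N (e : R) : 0 < e -> exists2 v : c0 R,
    forall k, (k < N)%N -> v k = 1 & `|y - T v| < e.
  move=> e0; apply: contrapT => nv.
  pose W := [set T u | u in [set u : c0 R | forall k, (k < N)%N -> u k = 0]].
  have [||v [u uN <-]|g gW] := @dual_separation R X W (y - w N) e _ _ e0.
  - by exists 0; [|rewrite linear0].
  - move=> a _ _ [u uN <-] [u' uN' <-]; exists (a *: u + u'); last by rewrite linearP.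
    by move=> k kN; rewrite c0_addE c0_scaleE uN// uN'// mulr0 addr0.
  - rewrite leNgt; apply/negP => yu; apply: nv.
    exists (c0_fin (fun=> 1) N + u); last by rewrite linearD opprD addrA.
    by move=> k kN; rewrite c0_addE c0_finE kN uN// addr0.
  (* A functional that kills [W] is constant on the [w n] with [n >= N], hence takes the same value
     at their weak limit [y]. *)
  - suff gy : g y = g (w N) by rewrite linearB /= gy subrr eqxx.
    rewrite -(cvg_lim (@Rhausdorff R) (wy g)); apply: (cvg_lim (@Rhausdorff R)).
    apply: cvg_near_cst; exists N => // n /= Nn.
    apply/eqP; rewrite -subr_eq0 -linearB; apply/eqP/gW.
    exists (c0_fin (fun=> 1) n - c0_fin (fun=> 1) N); last exact: linearB.
    by move=> k kN; rewrite c0_subE !c0_finE kN (leq_trans kN)// subrr.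
(* Two approximants of [y] within [c / 8] come from sequences less than 1/4 apart. The first, [v],
   is unconstrained; [n] is chosen after it with [|v n| < 1/2], and the second is 1 at [n], which
   takes [n.+1] leading ones. *)
have e0 : 0 < c / 8 by rewrite divr_gt0.
have [v _ yv] := approx 0 _ e0.
have h0 : 0 < 2^-1 :> R by [].
have /cvgrPdist_lt/(_ _ h0)[n _ /(_ n (leqnn n)) /=] := @c0_cvg R v.
rewrite sub0r normrN => vn.
have [u un yu] := approx n.+1 _ e0.
have uv : `|u - v| < 2^-1.
  rewrite -(ltr_pM2l c_gt0) (le_lt_trans (Tc _))// linearB.
  rewrite -(subrKA y) (le_lt_trans (ler_normD _ _))// distrC.
  by move: yu yv; lra.
have := le_lt_trans (c0_apply_le (u - v) n) uv.
rewrite c0_subE un// => uvn.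
have := ler_normD (1 - v n) (v n); rewrite subrK normr1.
by move: uvn vn; lra.
Qed.

End c0_obstruction.

(** The lower constant is a radius of continuity of the inverse at 0, the upper one a bound of [T]
    on the unit ball; both extend by scaling. *)
Lemma c0_embeds_operator (R : realType) (X : normedModType R) : c0_embeds X ->
  exists (T : {linear c0 R -> X}) (c C : R),
    [/\ 0 < c, forall u, c * `|u| <= `|T u| & forall u, `|T u| <= C * `|u|].
Proof.
move=> [Y _ [T [S [lT rT TS cT cS]]]].
pose T' : {linear c0 R -> X} := HB.pack T (GRing.isLinear.Build R _ _ _ T lT).
have scale (u : c0 R) : u != 0 -> `| `|u|^-1 *: u| = 1.
  by move=> u0; rewrite normrZ normfV normr_id mulVf// normr_eq0.
have [C CP] : exists C, forall u, `|u| <= 1 -> `|T' u| <= C.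
  by have /linear_bounded_continuous/bounded_funP := (cT : continuous T'); exact.
have S0 : S 0 = 0 by rewrite -(linear0 T') TS.
have Y0 : Y 0 by rewrite -rT; exists 0 => //; exact: (linear0 T').
have /subspace_continuousP/(_ 0 Y0) := cS.
rewrite /from_subspace S0 => /cvgrPdist_lt/(_ 1 ltr01).
rewrite near_withinE => /nbhs_normP[c /= c_gt0 cP].
have Tc u : `|T' u| < c -> `|u| < 1.
  move=> Tuc; have := cP (T u); rewrite /= sub0r normrN => /(_ Tuc).
  by rewrite TS sub0r normrN; apply; rewrite -rT; exists u.
exists T', c, C; split => // u.
  have [->|u0] := eqVneq u 0; first by rewrite normr0 mulr0.
  rewrite leNgt; apply/negP => uc.
  have := Tc (`|u|^-1 *: u); rewrite scale// ltxx linearZ normrZ normfV normr_id.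
  by rewrite mulrC ltr_pdivrMr ?normr_gt0// => /(_ uc).
have [->|u0] := eqVneq u 0; first by rewrite linear0 !normr0 mulr0.
have := CP (`|u|^-1 *: u); rewrite scale// lexx linearZ normrZ normfV normr_id.
by rewrite mulrC ler_pdivrMr ?normr_gt0// => /(_ isT).
Qed.

Theorem theorem3p9 (R : realType) (d : measure_display) (M : measurableType d)
    (mu : {sigma_finite_measure set M -> \bar R}%R)
    (X : completeNormedModType R) (x : M -> X) (f : M -> dual_space X) :
  separable X ->
  continuous_schauder_frame mu x f ->
  (boundedly_complete mu x f <-> ~ c0_embeds X).
Proof.
move=> _ xf; split; last exact: c0_free_boundedly_complete.
move=> bc /c0_embeds_operator[T [c [C [c_gt0 Tc TC]]]].
exact: (c0_not_bounded_below xf TC bc c_gt0).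
Qed.
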